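(* Let $A$ and $B$ be skew shapes. If $s_A = s_B$, or $\mathrm{supp}_s(A)=\mathrm{supp}_s(B)$, or $\mathrm{supp}_F(A)=\mathrm{supp}_F(B)$, then the following three equivalent conditions are true: (1) $\mathrm{rows}_k(A) = \mathrm{rows}_k(B)$ for all $k\ge 1$; (2) $\mathrm{cols}_\ell(A) = \mathrm{cols}_\ell(B)$ for all $\ell\ge 1$; (3) $\mathrm{rects}_{k,\ell}(A) = \mathrm{rects}_{k,\ell}(B)$ for all $k,\ell\ge 1$.
   Context: A composition of $n$ is a sequence of positive integers with sum $n$; a partition is a weakly decreasing composition. Compositions $\alpha=(\alpha_1,\dots,\alpha_k)$ of $n$ correspond bijectively to subsets of $[n-1]=\{1,\dots,n-1\}$ via $S(\alpha)=\{\alpha_1,\alpha_1+\alpha_2,\dots,\alpha_1+\cdots+\alpha_{k-1}\}$. Young diagrams are left-justified with row $1$ at the top; a skew shape $\lambda/\mu$ is the Young diagram of $\lambda$ with the boxes of $\mu\subseteq\lambda$ removed from its top-left. A standard Young tableau (SYT) of a skew shape $A$ with $n$ boxes is a filling of the boxes by $1,\dots,n$, each used once, increasing left to right along rows and down columns. Its descent set is the set of $i$ such that $i+1$ appears in a strictly lower row than $i$, and its descent composition is the composition of $n$ corresponding to its descent set. The monomial quasisymmetric functions are $M_\alpha=\sum_{i_1<\cdots<i_k}x_{i_1}^{\alpha_1}\cdots x_{i_k}^{\alpha_k}$, and the fundamental quasisymmetric functions are $F_\alpha=\sum_{S(\alpha)\subseteq S(\beta)\subseteq[n-1]}M_\beta$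 for $\alpha$ of size $n$. The skew Schur function is $s_A=\sum_T F_{\mathrm{comp}(T)}$, the sum being over all SYT $T$ of shape $A$, where $\mathrm{comp}(T)$ is the descent composition of $T$; it is a symmetric function, and the Schur functions are $s_\lambda=s_{\lambda/\emptyset}$. The $F$-support $\mathrm{supp}_F(A)$ is the set of compositions $\alpha$ such that $F_\alpha$ has positive coefficient in $s_A$. The Schur support $\mathrm{supp}_s(A)$ is the set of partitions $\lambda$ such that $s_\lambda$ has nonzero coefficient in the expansion of $s_A$ in the basis of Schur functions. For a skew shape $A$ with $r$ rows and $1\le i\le r-k+1$, let $\mathrm{overlap}_k(i)$ be the number of columns occupied in common by rows $i,i+1,\dots,i+k-1$; $\mathrm{rows}_k(A)$ is the partition obtained by sorting $(\mathrm{overlap}_k(1),\dots,\mathrm{overlap}_k(r-k+1))$ into weakly decreasing order and omitting zeros (so it is the empty partition if there are no nonzero overlaps). $\mathrm{cols}_\ell(A)$ is defined in the same way with the roles of rows and columns exchanged. $\mathrm{rects}_{k,\ell}(A)$ is the number of $k\times\ell$ rectangular subdiagrams ($k$ rows, $\ell$ columns, consecutive) contained in $A$. *)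

(* Defs.v *)
From HB Require Import structures.
From mathcomp Require Import all_boot all_order all_algebra finmap.

Set Implicit Arguments.
Unset Strict Implicit.
Unset Printing Implicit Defensive.

Import Order.TTheory GRing.Theory Num.Theory.
Local Open Scope nat_scope.

Definition is_comp (s : seq nat) : bool := 0 \notin s.
Definition is_part (s : seq nat) : bool := sorted geq s && (0 \notin s).

Record composition := Composition { comp_val :> seq nat; _ : is_comp comp_val }.
HB.instance Definition _ := [isSub for comp_val].
HB.instance Definition _ := [Choice of composition by <:].

Record intpart := IntPart { part_val :> seq nat; _ : is_part part_val }.
HB.instance Definition _ := [isSub for part_val].
HB.instance Definition _ := [Choice of intpart by <:].

(** Subsets of [n-1] = {1, ..., n-1} are represented by the sets of type
    [{set 'I_n}] that do not contain 0 (i.e. [D \subset interval n]). *)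
Definition interval (n : nat) : {set 'I_n} := [set i : 'I_n | 0 < i].

Definition set_of_comp (n : nat) (a : seq nat) : {set 'I_n} :=
  [set i : 'I_n | val i \in [seq sumn (take j a) | j <- iota 1 (size a).-1]].

(** Inverse of [set_of_comp n] (see [comp_of_setP], [set_of_compP]): successive
    differences of 0 < d_1 < ... < d_k < n.  For n = 0 these differences would
    give the non-composition [:: 0]. *)
Definition comp_of_set (n : nat) (D : {set 'I_n}) : seq nat :=
  if n is 0 then [::]
  else pairmap (fun x y => y - x) 0 (rcons [seq val i | i <- enum D] n).

Lemma partial_sumsE (a : seq nat) : 0 < size a ->
  scanl addn 0 a =
    rcons [seq sumn (take j a) | j <- iota 1 (size a).-1] (sumn a).
Proof.
have E x : scanl addn x a = [seq x + sumn (take j a) | j <- iota 1 (size a)].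
  elim: (a) x => //= y b IH x; rewrite take0 /= addn0 IH -[2]addn1 iotaDl.
  by rewrite -map_comp; congr cons; apply: eq_map => j /=; rewrite addnA.
move=> a_n0; rewrite E; have [k Ek] : exists k, size a = k.+1.
  by exists (size a).-1; rewrite prednK.
rewrite Ek -[k.+1]addn1 iotaD map_cat cats1 addn1 /= add1n -Ek take_size.
by congr rcons; apply: eq_map.
Qed.

Lemma comp_of_setP n (D : {set 'I_n}) : D \subset interval n ->
  [/\ is_comp (comp_of_set D), sumn (comp_of_set D) = n
    & set_of_comp n (comp_of_set D) = D].
Proof.
case: n D => [|n] D sD; first by split=> //; apply/setP=> - [].
rewrite /comp_of_set; set d := [seq val i | i <- enum D].
have d_sorted : sorted ltn (0 :: rcons d n.+1).
  have d0: sorted ltn d.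
    apply: (subseq_sorted ltn_trans) (iota_ltn_sorted 0 n.+1).
    rewrite -val_enum_ord; apply: map_subseq.
    by rewrite enumT {1}/enum_mem; apply: filter_subseq.
  rewrite /= rcons_path; apply/andP; split.
    rewrite path_sortedE ?d0 ?andbT; last exact: ltn_trans.
    apply/allP=> x /mapP[i]; rewrite mem_enum => /(subsetP sD).
    by rewrite inE => ? ->.
  have /allP : all (fun x => x < n.+1) (0 :: d).
    apply/allP=> x; rewrite inE => /orP[/eqP-> // | /mapP[i _ ->]].
    exact: ltn_ord.
  by move=> /(_ _ (mem_last 0 d)).
set s := rcons d n.+1 in d_sorted *.
have Es : scanl addn 0 (pairmap (fun x y => y - x) 0 s) = s.
  move: d_sorted; rewrite /=; elim: (s) (0) => //= y s' IH x /andP[xy ys].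
  by rewrite subnKC 1?ltnW // IH.
set a := pairmap _ 0 s in Es *.
have a_gt0 : 0 < size a by rewrite size_pairmap size_rcons.
rewrite partial_sumsE // in Es.
case/rcons_inj: Es => Ed En; split=> //.
  have pos x t : path ltn x t -> 0 \notin pairmap (fun x y => y - x) x t.
    elim: t x => //= y t IH x /andP[xy yt].
    by rewrite inE negb_or IH // andbT eq_sym subn_eq0 -ltnNge.
  exact: pos.
apply/setP=> i; rewrite inE Ed mem_map ?mem_enum //; exact: val_inj.
Qed.

Lemma set_of_compP n (a : seq nat) : is_comp a -> sumn a = n ->
  set_of_comp n a \subset interval n /\ comp_of_set (set_of_comp n a) = a.
Proof.
move=> a_pos sum_a; set d := [seq sumn (take j a) | j <- iota 1 (size a).-1].
have [a0 | a_n0] := eqVneq a [::].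
  by rewrite -{n}sum_a a0 /=; split=> //; apply/subsetP=> - [].
have n_gt0 : 0 < n.
  case: (a) a_n0 a_pos sum_a => // x b _; rewrite /is_comp inE negb_or eq_sym.
  by rewrite -lt0n => /andP[x0 _] <-; apply: ltn_addr.
have Ea : scanl addn 0 a = rcons d n.
  by rewrite partial_sumsE ?lt0n ?size_eq0 // sum_a.
have s_sorted : path ltn 0 (rcons d n).
  have inc x b : 0 \notin b -> path ltn x (scanl addn x b).
    elim: b x => //= y b IH x; rewrite inE negb_or => /andP[y0 b0].
    by rewrite IH // andbT -{1}[x]addn0 ltn_add2l lt0n eq_sym.
  by rewrite -Ea inc.
have d_bnd i : i \in d -> 0 < i < n.
  move=> d_i; move: s_sorted; rewrite -cats1 cat_path /= andbT.
  rewrite (path_sortedE ltn_trans) => /andP[/andP[/allP-> // d_srt] lt_n].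
  move: lt_n d_i d_srt; case/lastP: (d) => // s x; rewrite last_rcons => lt_n.
  rewrite mem_rcons inE => /orP[/eqP-> // | s_i].
  rewrite -cats1 (sorted_pairwise ltn_trans) pairwise_cat.
  by case/andP=> /allrelP/(_ i x s_i (mem_head _ _))/ltn_trans/(_ lt_n).
split; first by apply/subsetP=> i; rewrite !inE => /d_bnd/andP[].
rewrite /comp_of_set; case: n n_gt0 d_bnd s_sorted {sum_a} Ea => // n _ d_bnd s_sorted Ea.
suff -> : [seq val i | i <- enum (set_of_comp n.+1 a)] = d.
  by rewrite -Ea; elim: (a) (0) => //= x b IH y; rewrite IH addKn.
apply: (irr_sorted_eq ltn_trans ltnn) => [||i].
- apply: (subseq_sorted ltn_trans) (iota_ltn_sorted 0 n.+1).
  rewrite -val_enum_ord; apply: map_subseq.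
  by rewrite enumT {1}/enum_mem; apply: filter_subseq.
- by move: s_sorted; rewrite rcons_path => /andP[/path_sorted].
apply/mapP/idP => [[j] | d_i].
  by rewrite mem_enum inE => ? ->.
have /andP[_ lt_i] := d_bnd i d_i.
by exists (Ordinal lt_i); rewrite ?mem_enum ?inE.
Qed.

(** Formal power series in x_0, x_1, x_2, ... with integer coefficients:
    [f m] is the coefficient of the monomial [m], an exponent vector of
    finite support. *)
Definition monom := {fsfun nat -> nat with 0}.
Definition series := monom -> int.

(** Nonzero exponents of [m], by increasing index of the variable. *)
Definition exponents (m : monom) : seq nat :=
  [seq m i | i <- sort leq (enum_fset (finsupp m))].

(** For a composition [a], at most one i_1 < ... < i_k gives
    x_{i_1}^{a_1} ... x_{i_k}^{a_k} = m; see [monomial_qsymP] below. *)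
Definition monomial_qsym (a : seq nat) : series :=
  fun m => ((exponents m == a)%:R)%R.

Lemma monomial_qsymP (a : seq nat) (m : monom) : is_comp a ->
  reflect (exists i : seq nat,
             [/\ sorted ltn i, size i = size a
               & forall v, m v = \sum_(j < size a | nth 0 i j == v) nth 0 a j])
          (exponents m == a).
Proof.
move=> a_pos.
have sum_idx (i : seq nat) v c : uniq i ->
    \sum_(j < size i | nth 0 i j == v) c = (v \in i) * c.
  move=> Ui; rewrite -count_uniq_mem // -sum1_count big_distrl /=.
  rewrite (big_nth 0) big_mkord; apply: eq_bigr => j _.
  by rewrite mul1n.
apply: (iffP eqP) => [<- | [i [i_lt sz_i Em]]].
  rewrite /exponents size_map; set i := sort leq _.
  have Ui : uniq i by rewrite sort_uniq fset_uniq.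
  exists i; split=> // [|v].
    by rewrite ltn_sorted_uniq_leq Ui (sort_sorted leq_total).
  rewrite (eq_bigr (fun=> m v)) => [|j /eqP <-]; last first.
    by rewrite (nth_map 0) // ltn_ord.
  rewrite sum_idx // mem_sort -[_ \in _]/(v \in finsupp m).
  by case: finsuppP; rewrite ?mul1n.
have Ui : uniq i by move: i_lt; rewrite ltn_sorted_uniq_leq => /andP[].
have mi (j : nat) : j < size a -> m (nth 0 i j) = nth 0 a j.
  move=> lt_j; rewrite Em.
  rewrite (eq_bigr (fun=> nth 0 a j)) => [|k].
    by rewrite -sz_i sum_idx // mem_nth ?mul1n // sz_i.
  by rewrite nth_uniq ?sz_i ?ltn_ord // => /eqP->.
have supp_i : finsupp m =i i.
  move=> v; rewrite mem_finsupp.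
  have [/(nthP 0)[j] | /memPn v_i] := boolP (v \in i).
    rewrite sz_i => lt_j <-; rewrite mi //.
    by apply: contraNneq a_pos => <-; rewrite mem_nth.
  rewrite Em big_pred0 => // j; apply: contraTF (ltn_ord j) => /eqP Ev.
  apply/negP => lt_j; have := lt_j; rewrite -[X in _ < X]sz_i => /(mem_nth 0)/v_i.
  by rewrite Ev eqxx.
have -> : exponents m = [seq m x | x <- i].
  congr (map _ _); apply: (irr_sorted_eq ltn_trans ltnn) => // [|v].
    by rewrite ltn_sorted_uniq_leq sort_uniq fset_uniq (sort_sorted leq_total).
  by rewrite mem_sort -supp_i.
apply: (@eq_from_nth _ 0); rewrite size_map // => j lt_j.
by rewrite (nth_map 0) // mi // -sz_i.
Qed.

Definition fundamental_qsym (a : seq nat) : series := fun m =>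
  (\sum_(D : {set 'I_(sumn a)} |
       (set_of_comp (sumn a) a \subset D) && (D \subset interval (sumn a)))
      monomial_qsym (comp_of_set D) m)%R.

(** Skew shapes; rows and columns are numbered from 0. *)
Record skew_shape := SkewShape {
  outer : intpart;
  inner : intpart;
  _ : forall i, nth 0 inner i <= nth 0 outer i
}.

Definition nrows (A : skew_shape) : nat := size (outer A).
Definition ncols (A : skew_shape) : nat := head 0 (outer A).

Definition in_shape (A : skew_shape) (i j : nat) : bool :=
  nth 0 (inner A) i <= j < nth 0 (outer A) i.

Definition box (A : skew_shape) : finType :=
  {x : 'I_(nrows A) * 'I_(ncols A) | in_shape A x.1 x.2}.
Definition box_row (A : skew_shape) (x : box A) : nat := (val x).1.
Definition box_col (A : skew_shape) (x : box A) : nat := (val x).2.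
Definition nboxes (A : skew_shape) : nat := #|box A|.

(** The entry in [x] of the filling [T] is [(T x).+1], in {1, ..., n}. *)
Definition filling (A : skew_shape) := {ffun box A -> 'I_(nboxes A)}.
Definition entry (A : skew_shape) (T : filling A) (x : box A) : nat := (T x).+1.

Definition is_SYT (A : skew_shape) (T : filling A) : bool :=
  [&& injectiveb T,
      [forall x, forall y, (box_row x == box_row y) && (box_col x < box_col y)
                             ==> (entry T x < entry T y)]
    & [forall x, forall y, (box_col x == box_col y) && (box_row x < box_row y)
                             ==> (entry T x < entry T y)]].

Definition descent_set (A : skew_shape) (T : filling A) : {set 'I_(nboxes A)} :=
  [set i : 'I_(nboxes A) | [exists x, exists y,
     [&& entry T x == i, entry T y == i.+1 & box_row x < box_row y]]].

Definition descent_comp (A : skew_shape) (T : filling A) : seq nat :=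
  comp_of_set (descent_set T).

Definition skew_schur (A : skew_shape) : series := fun m =>
  (\sum_(T : filling A | is_SYT T) fundamental_qsym (descent_comp T) m)%R.

Definition empty_part : intpart := @IntPart [::] isT.

Lemma straight_subproof (l : intpart) i : nth 0 empty_part i <= nth 0 l i.
Proof. by rewrite nth_nil. Qed.

Definition straight (l : intpart) : skew_shape := SkewShape (straight_subproof l).

Definition schur (l : intpart) : series := skew_schur (straight l).

(** [c] gives the coefficients of an expansion of [f] as a finite linear
    combination of the family [b].  When [b] is linearly independent, as are
    the fundamental and the Schur functions, there is at most one such [c]. *)
Definition expansion (I : choiceType) (b : I -> series) (f : series)
    (c : {fsfun I -> int with 0%R}) : Prop :=
  forall m, f m = (\sum_(i <- finsupp c) c i * b i m)%R.

Definition supp_F (A : skew_shape) (a : composition) : Prop :=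
  exists2 c, expansion (fun a : composition => fundamental_qsym a) (skew_schur A) c
           & (0 < c a)%R.

Definition supp_s (A : skew_shape) (l : intpart) : Prop :=
  exists2 c, expansion schur (skew_schur A) c & (c l != 0)%R.

(** For a diagram [D] with [r] rows and [c] columns ([D i j]: the box in row i
    and column j is present). *)
Definition overlap (D : rel nat) (c k i : nat) : nat :=
  count (fun j => all (fun p => D p j) (iota i k)) (iota 0 c).

(** With rows numbered from 0, overlap_k is defined at 0 <= i <= r - k. *)
Definition overlap_part (D : rel nat) (r c k : nat) : seq nat :=
  sort geq [seq x <- [seq overlap D c k i | i <- iota 0 (r.+1 - k)] | x != 0].

Definition rows (k : nat) (A : skew_shape) : seq nat :=
  overlap_part (in_shape A) (nrows A) (ncols A) k.

Definition cols (l : nat) (A : skew_shape) : seq nat :=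
  overlap_part (fun j i => in_shape A i j) (ncols A) (nrows A) l.

(** Rectangles are counted by the position of their top left box. *)
Definition rects (k l : nat) (A : skew_shape) : nat :=
  #|[set x : 'I_(nrows A) * 'I_(ncols A) |
      [forall p : 'I_k, forall q : 'I_l, in_shape A (x.1 + p) (x.2 + q)]]|.

(* Main.v *)
Require Import Defs.
From mathcomp Require Import all_boot all_order all_algebra finmap zify.

Set Implicit Arguments.
Unset Strict Implicit.
Unset Printing Implicit Defensive.

Import Order.TTheory GRing.Theory Num.Theory.

(** A skew tableau is encoded by the word listing the rows of its entries
    1, 2, ..., n; its descents are the ascents of the word. The greatest initial
    run without descents that is possible in shape [A] has one entry for each
    nonempty column, and then it fills the top boxes of the columns; hence the
    tableaux starting with such a run correspond to the tableaux of the shape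
    [peel A] obtained by deleting these boxes. Transposing a tableau complements
    its descent set. So each of the three hypotheses on [A] and [B] passes to
    [peel A], [peel B] and to the transposes, and it determines the number of
    boxes. As a box of [peel A] is a vertical domino of [A], iterating both
    operations shows that the numbers of rectangles agree.

    For Schur supports this needs that [s_A] is a combination of Schur
    functions, which follows from its symmetry (proved by reflecting
    Gelfand-Tsetlin patterns), but not that the coefficients are nonnegative.
    Finally [rects k l] is the sum of [x - (l - 1)] over the parts [x >= l] of
    [rows k], and these sums for all [l] determine [rows k]. *)

(** * Lattice words *)

(** Words are counted with their ascent set between two predicates [P] and [Q]. Taking [P = Q]
    prescribes the descent set and gives the coefficients of fundamental functions; taking [P] empty
    gives the coefficients of monomials. The counts are additive when such an interval of sets is
    split at one position, so each kind of coefficient determines the other.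

    The obstacle with Schur supports is cancellation, since coefficients may have any sign. Let [m]
    be the longest first row in the support of [A]. Descent sets with first descent [m] see only the
    shapes with first row exactly [m], and the sum of these cannot vanish identically, because the
    descent counts of straight shapes are linearly independent. Hence [m] is the number of nonempty
    columns of [A], and the support of [peel A] consists of these shapes without their first rows.
    The values of the coefficients do not enter, so a shape [B] with the same support behaves alike.

    Supports are defined through the existence of an expansion: if there were none, they would be
    empty and say nothing. So both existence and uniqueness of expansions have to be established. *)

Definition noninc (f : nat -> nat) := forall i, f i.+1 <= f i.

Lemma noninc_le f i j : noninc f -> i <= j -> f j <= f i.
Proof.
move=> f_dec; elim: j => [|j IH]; first by rewrite leqn0 => /eqP->.
by rewrite leq_eqVlt => /orP[/eqP-> // | /IH]; apply: leq_trans.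
Qed.

(** A letter [i] adds a box at the end of row [i]; these are the row lengths reached from [mu]. A
    function on all rows avoids bookkeeping of trailing empty rows. *)
Definition sh (mu : nat -> nat) (w : seq nat) (i : nat) := mu i + count_mem i w.

Lemma sh_cat mu u v : sh mu (u ++ v) =1 sh (sh mu u) v.
Proof. by move=> i; rewrite /sh count_cat addnA. Qed.

Lemma sh_le mu w i : mu i <= sh mu w i.
Proof. exact: leq_addr. Qed.

Lemma sh_take_le mu k w i : sh mu (take k w) i <= sh mu w i.
Proof. by rewrite -{2}[w](cat_take_drop k) sh_cat sh_le. Qed.

(** Boxes are appended at row ends, so rows increase automatically; this condition says that columns
    increase too. *)
Definition lattice mu w := forall k, noninc (sh mu (take k w)).

Lemma eq_lattice mu nu w : mu =1 nu -> lattice mu w -> lattice nu w.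
Proof. by move=> E H k i; rewrite /sh -!E; apply: H. Qed.

Lemma lattice_end mu w : lattice mu w -> noninc (sh mu w).
Proof. by move=> /(_ (size w)); rewrite take_size. Qed.

Lemma lattice_cat mu u v :
  lattice mu (u ++ v) <-> lattice mu u /\ lattice (sh mu u) v.
Proof.
split=> [H | [H1 H2] k i].
  split=> k i.
    have [le_k|lt_k] := leqP k (size u).
      by have := H k i; rewrite takel_cat.
    have := H (size u) i; rewrite take_size_cat //.
    by rewrite take_oversize // ltnW.
  by have := H (size u + k) i; rewrite take_cat ltnNge leq_addr /= addKn !sh_cat.
rewrite take_cat; case: ifP => [_|_]; first exact: H1.
by rewrite !sh_cat; apply: H2.
Qed.

(* A weakly decreasing word adds its boxes from bottom to top, so all boxes of
   row [i.+1] come before those of row [i]. *)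
Lemma lattice_sorted mu u : noninc mu -> sorted geq u ->
  lattice mu u <-> (forall i, sh mu u i.+1 <= mu i).
Proof.
move=> mu_dec u_dec; split=> H; last first.
  by move=> k i; apply: leq_trans (sh_take_le _ _ _ _) _;
     apply: leq_trans (H i) (sh_le _ _ _).
move=> i; pose v := filter (fun x => i < x) u; pose v' := filter (fun x => x <= i) u.
have Eu : u = v ++ v'.
  rewrite /v /v'; elim: (u) u_dec => //= x s IH x_s.
  have /IH {}IH := path_sorted x_s.
  have [lt_i|le_i] /= := ltnP i x; first by rewrite -IH.
  have /allP x_max : all (geq x) s.
    by apply: order_path_min x_s => a b c /= ? /leq_trans; apply.
  have -> : [seq y <- s | i < y] = [::].
    apply/eqP; rewrite -[_ == _]negbK -has_filter; apply/hasPn => y /x_max le_y.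
    by rewrite -leqNgt (leq_trans le_y).
  by congr cons; apply/esym/all_filterP/allP => y /x_max /leq_trans; apply.
have := H (size v) i; rewrite Eu take_size_cat // /sh count_cat.
rewrite (count_memPn (_ : i \notin v)) ?addn0; last by rewrite mem_filter ltnn.
by rewrite (count_memPn (_ : i.+1 \notin v')) ?addn0 // mem_filter ltnn.
Qed.

(** Entry [i] of a tableau stands at index [i.-1] of its word, so this compares the rows of the
    entries [i] and [i.+1]. A lower row is a greater letter. *)
Definition ascent (w : seq nat) i := nth 0 w i.-1 < nth 0 w i.

Definition is_word mu la (P Q : pred nat) w :=
  [/\ lattice mu w, sh mu w =1 la
    & forall i, 0 < i < size w -> (P i -> ascent w i) /\ (ascent w i -> Q i)].

(** A boolean form of [is_word], made for counting: rows from [R] on are empty and prefixes are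
    bounded by the word, so finitely many tests suffice ([wordP]). *)
Definition word R mu la (P Q : pred nat) w :=
  [&& all (fun k => all (fun i => sh mu (take k w) i.+1 <= sh mu (take k w) i)
            (iota 0 R)) (iota 0 (size w).+1),
      all (fun i => sh mu w i == la i) (iota 0 R)
    & all (fun i => (P i ==> ascent w i) && (ascent w i ==> Q i))
        (iota 1 (size w).-1)].

Definition all_words R n : seq (seq nat) :=
  [seq [seq val i | i <- tval t] | t <- enum {: n.-tuple 'I_R}].

Lemma all_words_uniq R n : uniq (all_words R n).
Proof.
rewrite map_inj_uniq ?enum_uniq // => s t /inj_map E.
by apply: val_inj; apply: E; apply: val_inj.
Qed.

Lemma mem_all_words R n w :
  (w \in all_words R n) = (size w == n) && all (fun x => x < R) w.
Proof.
apply/mapP/andP => [[t _ ->] | [/eqP sz_w w_R]].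
  rewrite size_map size_tuple; split=> //.
  by apply/allP => _ /mapP[i _ ->]; apply: ltn_ord.
have Ew : map val (pmap insub w : seq 'I_R) = w.
  rewrite pmap_filter; last exact: insubK.
  by apply/all_filterP; apply: sub_all w_R => x ltx; rewrite insubT.
have sz : size (pmap insub w : seq 'I_R) == n by rewrite -(size_map val) Ew sz_w.
by exists (Tuple sz); rewrite ?mem_enum.
Qed.

Definition nwords R n mu la P Q := count (word R mu la P Q) (all_words R n).

Lemma size_le_inj (S T : eqType) (s : seq S) (t : seq T) (g : S -> T) :
  uniq s -> {in s, forall x, g x \in t} -> {in s &, injective g} ->
  size s <= size t.
Proof.
move=> Us g_st g_inj; rewrite -(size_map g); apply: uniq_leq_size.
  by rewrite map_inj_in_uniq.
by move=> _ /mapP[x s_x ->]; apply: g_st.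
Qed.

Section Words.
Variables (R : nat) (mu la : nat -> nat).
Hypotheses (mu_dec : noninc mu) (la_dec : noninc la).
Hypotheses (mu_la : forall i, mu i <= la i) (la_R : forall i, R <= i -> la i = 0).
Implicit Types (P Q : pred nat) (w : seq nat).

Lemma is_word_letters P Q w : is_word mu la P Q w -> all (fun x => x < R) w.
Proof.
case=> _ Ew _; apply/allP => x w_x; rewrite ltnNge; apply/negP => /la_R la0.
have /count_memPn/negP[] : count_mem x w = 0.
  by apply/eqP; rewrite -leqn0 -la0 -Ew leq_addl.
exact: w_x.
Qed.

Lemma wordP P Q w : all (fun x => x < R) w ->
  reflect (is_word mu la P Q w) (word R mu la P Q w).
Proof.
move=> /allP w_R.
have sh0 k i : R <= i -> sh mu (take k w) i = 0.
  move=> le_i; have /count_memPn : i \notin take k w.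
    by apply/negP => /mem_take/w_R; rewrite ltnNge le_i.
  by rewrite /sh => ->; apply/eqP; rewrite addn0 -leqn0 -(la_R le_i).
apply: (iffP and3P) => [[/allP H1 /allP H2 /allP H3] | [H1 H2 H3]]; split.
- move=> k i; have [lt_i|le_i] := ltnP i R; last by rewrite sh0 // leqW.
  wlog le_k : k / k <= size w => [H|].
    have [/H//|lt_k] := leqP k (size w).
    have -> : take k w = take (size w) w by rewrite take_size take_oversize // ltnW.
    exact: H.
  have /H1/allP/(_ i) : k \in iota 0 (size w).+1 by rewrite mem_iota.
  by apply; rewrite mem_iota.
- move=> i; have [lt_i|le_i] := ltnP i R.
    by apply/eqP/H2; rewrite mem_iota.
  by rewrite la_R // -{1}[w]take_size sh0.
- move=> i /andP[i0 lt_i].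
  have /andP[/implyP ? /implyP ?] : (P i ==> ascent w i) && (ascent w i ==> Q i).
    by apply: H3; rewrite mem_iota i0 add1n prednK // (leq_ltn_trans _ lt_i).
  by [].
- by apply/allP=> k _; apply/allP=> i _; apply: H1.
- by apply/allP=> i _; apply/eqP.
apply/allP=> i; rewrite mem_iota add1n => /andP[i0 lt_i].
have [|? ?] := H3 i; last by apply/andP; split; apply/implyP.
by rewrite i0 /=; case: (size w) lt_i i0 => //=; case: i.
Qed.

Lemma mem_words P Q n w :
  w \in filter (word R mu la P Q) (all_words R n) <->
  size w = n /\ is_word mu la P Q w.
Proof.
rewrite mem_filter mem_all_words; split=> [/and3P[H /eqP sz_w w_R] | [sz_w H]].
  by split=> //; apply/wordP.
have w_R := is_word_letters H.
by rewrite sz_w eqxx w_R !andbT; apply/wordP.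
Qed.

Lemma words_ex P Q n :
  (exists w, size w = n /\ is_word mu la P Q w) <-> 0 < nwords R n mu la P Q.
Proof.
rewrite /nwords -size_filter -has_predT; split=> [[w H]|/hasP[w w_in _]].
  by apply/hasP; exists w => //; apply/mem_words.
by exists w; apply/mem_words.
Qed.

End Words.

(** Equalities between word counts are mostly obtained from two such injections, one in each
    direction. *)
Lemma nwords_le R mu la P Q n R' mu' la' P' Q' n' (g : seq nat -> seq nat) :
  (forall i, mu i <= la i) -> (forall i, R <= i -> la i = 0) ->
  (forall i, mu' i <= la' i) -> (forall i, R' <= i -> la' i = 0) ->
  (forall w, size w = n -> is_word mu la P Q w ->
     size (g w) = n' /\ is_word mu' la' P' Q' (g w)) ->
  (forall w w', size w = n -> is_word mu la P Q w ->
     size w' = n -> is_word mu la P Q w' -> g w = g w' -> w = w') ->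
  nwords R n mu la P Q <= nwords R' n' mu' la' P' Q'.
Proof.
move=> ? ? ? ? g_in g_inj; rewrite /nwords -!size_filter.
apply: (@size_le_inj _ _ _ _ g) => [|w|w w'].
- by rewrite filter_uniq ?all_words_uniq.
- by move=> /mem_words[]// ? ?; apply/mem_words => //; apply: g_in.
by move=> /mem_words[]// ? ? /mem_words[]// ? ?; apply: g_inj.
Qed.

(** * Longest initial runs without descents *)

Lemma sorted_ascent u :
  sorted geq u <-> (forall i, 0 < i < size u -> ascent u i = false).
Proof.
split=> [/sortedP H [//|i] /(H 0) /= | H].
  by rewrite /ascent ltnNge => ->.
by apply/(sortedP 0) => i lt_i; rewrite /= leqNgt; apply/negbT/(H i.+1).
Qed.

Lemma ascent_catl u v i : i < size u -> ascent (u ++ v) i = ascent u i.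
Proof.
by move=> lt_i; rewrite /ascent !nth_cat lt_i (leq_ltn_trans (leq_pred i)).
Qed.

Lemma ascent_catr u v i : 0 < i -> ascent (u ++ v) (size u + i) = ascent v i.
Proof.
have E j : nth 0 (u ++ v) (size u + j) = nth 0 v j.
  by rewrite nth_cat ltnNge leq_addr /= addKn.
by case: i => // i _; rewrite /ascent E addnS /= E.
Qed.

Lemma size_count_mem R w : all (fun x => x < R) w ->
  size w = \sum_(i < R) count_mem (val i) w.
Proof.
elim: w => [|x w IH] /=; first by rewrite big1.
move=> /andP[lt_x /IH->]; rewrite big_split /= -add1n; congr addn.
rewrite (bigD1 (Ordinal lt_x)) //= eqxx big1 ?addn0 // => i.
by rewrite -val_eqE /= eq_sym => /negbTE->.
Qed.

Lemma sorted_geq_eq u v : sorted geq u -> sorted geq v ->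
  (forall i, count_mem i u = count_mem i v) -> u = v.
Proof.
move=> su sv E; apply: (@sorted_eq _ geq) => //.
- by move=> a b c /= ? /leq_trans; apply.
- by move=> a b /=; rewrite andbC => /anti_leq.
by apply/allP => x _; apply/eqP.
Qed.

(** A weakly decreasing word is determined by its multiplicities, so a run without descents is
    determined by the shapes before and after it. *)
Fixpoint dec_word (R : nat) (f : nat -> nat) : seq nat :=
  if R is r.+1 then nseq (f r) r ++ dec_word r f else [::].

Lemma count_dec_word R f i :
  count_mem i (dec_word R f) = if i < R then f i else 0.
Proof.
elim: R => //= r IH; rewrite count_cat IH count_nseq ltnS /=.
by case: ltngtP => [||->]; rewrite ?mul0n ?mul1n ?addn0.
Qed.

Lemma dec_word_letters R f : all (fun x => x < R) (dec_word R f).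
Proof.
elim: R => //= r IH; rewrite all_cat all_nseq ltnSn orbT /=.
by apply: sub_all IH => x /= /ltnW.
Qed.

Lemma dec_word_sorted R f : sorted geq (dec_word R f).
Proof.
have tr : transitive geq by move=> a b c /= ? /leq_trans; apply.
rewrite sorted_pairwise //.
elim: R => //= r IH; rewrite pairwise_cat IH andbT; apply/andP; split.
  apply/allrelP => x y; rewrite mem_nseq => /andP[_ /eqP->].
  by move=> /(allP (dec_word_letters r f)) /ltnW.
by rewrite -sorted_pairwise //; elim: (f r) => //= k; case: k => //= k ->; rewrite leqnn.
Qed.

Lemma size_dec_word R f : size (dec_word R f) = \sum_(i < R) f i.
Proof.
rewrite (size_count_mem (dec_word_letters R f)).
by apply: eq_bigr => i _; rewrite count_dec_word ltn_ord.
Qed.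

(** In row [i > 0] of [la/mu] the boxes without a box of [la/mu] above them are those in columns
    below [mu (i - 1)]. So this is [mu] with the top boxes of all columns added, the greatest
    extension of [mu] by a horizontal strip inside [la]. *)
Definition top (mu la : nat -> nat) i :=
  if i is j.+1 then minn (la i) (mu j) else la 0.

Section Greedy.
Variables (R : nat) (mu la : nat -> nat).
Hypotheses (mu_dec : noninc mu) (la_dec : noninc la).
Hypotheses (mu_la : forall i, mu i <= la i) (la_R : forall i, R <= i -> la i = 0).
Implicit Types (P Q : pred nat) (w u v : seq nat).

Let tau := top mu la.

Lemma top_dec : noninc tau.
Proof. by move=> [|i]; rewrite /tau /= ?leq_min !geq_min ?la_dec ?mu_dec ?orbT. Qed.

Lemma top_le i : tau i <= la i.
Proof. by case: i => [|i] //=; apply: geq_minl. Qed.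

Lemma le_top i : mu i <= tau i.
Proof. by case: i => [|i]; rewrite /tau /= ?leq_min mu_la ?mu_dec. Qed.

(** Every nonempty column of [la/mu] has one top box, so this counts the nonempty columns. *)
Definition ntop := \sum_(i < R) (tau i - mu i).

Lemma sorted_prefix u v : lattice mu (u ++ v) -> sh mu (u ++ v) =1 la ->
  sorted geq u -> forall i, sh mu u i <= tau i.
Proof.
move=> /lattice_cat[lat_u _] Ela su [|i] /=.
  by rewrite /tau /= -Ela sh_cat sh_le.
rewrite /tau /= leq_min -Ela sh_cat sh_le /=.
by move/(lattice_sorted mu_dec su): lat_u; apply.
Qed.

Lemma sorted_prefix_size u v : lattice mu (u ++ v) -> sh mu (u ++ v) =1 la ->
  sorted geq u -> size u <= ntop.
Proof.
move=> lat Ela su; have w_R : all (fun x => x < R) (u ++ v).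
  apply: (is_word_letters (mu := mu) la_R (P := pred0) (Q := predT)).
  by split.
move: w_R; rewrite all_cat => /andP[u_R _].
rewrite (size_count_mem u_R); apply: leq_sum => i _.
by rewrite leq_subRL ?le_top //; apply: sorted_prefix lat Ela su _.
Qed.

Lemma first_block P Q w m : is_word mu la P Q w ->
  (forall i, 0 < i < m -> Q i = false) -> m <= size w -> m <= ntop.
Proof.
move=> [lat Ela Asc] Q0 le_m; rewrite -(size_takel le_m).
apply: (@sorted_prefix_size _ (drop m w)); rewrite ?cat_take_drop //.
apply/sorted_ascent => i; rewrite size_takel // => /andP[i0 lt_i].
rewrite -(ascent_catl (drop m w)) ?size_takel // cat_take_drop.
have [|_ H] := Asc i; first by rewrite i0 (leq_trans lt_i).
by apply/negbTE/negP => /H; rewrite Q0 ?i0.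
Qed.

Definition top_word := dec_word R (fun i => tau i - mu i).

Lemma size_top_word : size top_word = ntop.
Proof. exact: size_dec_word. Qed.

Lemma sh_top_word : sh mu top_word =1 tau.
Proof.
move=> i; rewrite /sh count_dec_word; case: ltnP => [_|/la_R la0].
  by rewrite subnKC ?le_top.
by apply/eqP; rewrite addn0 eqn_leq le_top (leq_trans (top_le i)) // la0.
Qed.

Lemma lattice_top_word : lattice mu top_word.
Proof.
apply/(lattice_sorted mu_dec (dec_word_sorted _ _)) => i.
by rewrite sh_top_word geq_minr.
Qed.

Section Pattern.
Variables (P1 Q1 P Q : pred nat).
Hypothesis (PQ_lo : forall i, 0 < i < ntop -> P1 i = false /\ Q1 i = false).
(** At the junction only [Q1] is constrained: it has to allow an ascent, and an ascent does follow
    the longest run. This covers a prescribed junction ([syt_peel_ext]) as well as one that is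
    merely allowed ([kost_peel]). *)
Hypothesis (PQ_eq : 0 < ntop -> Q1 ntop).
Hypothesis (PQ_hi : forall i, 0 < i -> P1 (ntop + i) = P i /\ Q1 (ntop + i) = Q i).

Lemma greedy_word v : is_word tau la P Q v -> is_word mu la P1 Q1 (top_word ++ v).
Proof.
move=> [lat Ela Asc].
have latw : lattice mu (top_word ++ v).
  apply/lattice_cat; split; first exact: lattice_top_word.
  by apply: eq_lattice lat => i; rewrite sh_top_word.
have Elaw : sh mu (top_word ++ v) =1 la.
  by move=> i; rewrite sh_cat -Ela /sh; congr addn; apply: sh_top_word.
split=> // i; rewrite size_cat size_top_word => /andP[i0 lt_i].
have [lt_c|lt_c|Ei] := ltngtP i ntop.
- have [|-> ->] := PQ_lo (i := i); first by rewrite i0.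
  rewrite ascent_catl ?size_top_word //.
  have /sorted_ascent -> // := dec_word_sorted R (fun i => tau i - mu i).
  by rewrite i0 size_top_word.
- rewrite -(subnKC (ltnW lt_c)) -[X in ascent _ (X + _)]size_top_word.
  have j0 : 0 < i - ntop by rewrite subn_gt0.
  by rewrite ascent_catr //; have [-> ->] := PQ_hi j0; apply: Asc; lia.
have ntop0 : 0 < ntop by rewrite -Ei.
rewrite Ei PQ_eq //; split=> // _.
(* Otherwise the top word could be prolonged to a longer first block. *)
case Ev : v => [|x v']; first by move: lt_i; rewrite Ei Ev addn0 ltnn.
apply/negPn/negP; rewrite /ascent nth_cat size_top_word prednK // leqnn.
rewrite nth_cat size_top_word ltnn subnn /= -leqNgt => le_x.
suff : ntop.+1 <= ntop by rewrite ltnn.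
have <- : size (rcons top_word x) = ntop.+1 by rewrite size_rcons size_top_word.
apply: (@sorted_prefix_size _ v'); rewrite ?cat_rcons -?Ev //.
have := dec_word_sorted R (fun i => tau i - mu i); rewrite -/top_word.
move: le_x; rewrite -size_top_word nth_last; case: (top_word) => //= y s.
by rewrite rcons_path => le_x ->.
Qed.

(** The first [ntop] letters form a run and so reach a shape below [tau]. Having the size of
    [tau/mu], they reach [tau] itself, and being sorted they are [top_word]. *)
Lemma greedy_word_inv w : ntop <= size w -> is_word mu la P1 Q1 w ->
  w = top_word ++ drop ntop w /\ is_word tau la P Q (drop ntop w).
Proof.
move=> le_c isw; have [lat Ela Asc] := isw; set u := take ntop w.
have su : sorted geq u.
  apply/sorted_ascent => i; rewrite size_takel // => /andP[i0 lt_i].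
  rewrite -(ascent_catl (drop ntop w)) ?size_takel // cat_take_drop.
  have [|_ H] := Asc i; first by rewrite i0 (leq_trans lt_i).
  by apply/negbTE/negP => /H; rewrite (proj2 (PQ_lo _)) ?i0.
have le_u : forall i, sh mu u i <= tau i.
  by apply: (@sorted_prefix _ (drop ntop w)); rewrite ?cat_take_drop.
have w_R := is_word_letters la_R isw.
have u_R : all (fun x => x < R) u by apply/allP => x /mem_take/(allP w_R).
have Eu i : count_mem i u = tau i - mu i.
  have [lt_i|le_i] := ltnP i R; last first.
    rewrite (count_memPn _) ?la_R //; last first.
      by apply/negP => /(allP u_R); rewrite ltnNge le_i.
    by apply/esym/eqP; rewrite subn_eq0 (leq_trans (top_le i)) // la_R.
  have le_cnt (j : 'I_R) : true -> count_mem (val j) u <= tau j - mu j.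
    by move=> _; rewrite leq_subRL ?le_top ?le_u.
  (* Termwise inequalities with equal sums are equalities. *)
  have := leqif_sum (fun j Pj => leqif_eq (le_cnt j Pj)).
  rewrite -(size_count_mem u_R) size_takel // => - [_]; rewrite eqxx.
  by move=> /esym/forallP/(_ (Ordinal lt_i))/eqP.
have Eu' : u = top_word.
  apply: sorted_geq_eq => //; first exact: dec_word_sorted.
  move=> i; rewrite Eu count_dec_word; case: ltnP => // le_i.
  by apply/eqP; rewrite subn_eq0 (leq_trans (top_le i)) // la_R.
have Ew : w = top_word ++ drop ntop w by rewrite -Eu' cat_take_drop.
split=> //; move: lat Ela Asc; rewrite Ew.
move=> /lattice_cat[_ lat] Ela Asc.
rewrite drop_size_cat ?size_top_word //; split.
- by apply: eq_lattice lat; apply: sh_top_word.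
- by move=> i; rewrite -Ela sh_cat /sh; congr addn; rewrite -sh_top_word.
move=> i /andP[i0 lt_i]; have [|] := Asc (ntop + i).
  by rewrite size_cat size_top_word ltn_add2l lt_i addn_gt0 i0 orbT.
have [-> ->] := PQ_hi i0.
by rewrite -[X in ascent _ (X + i)]size_top_word ascent_catr.
Qed.

Lemma nwords_greedy n : nwords R (ntop + n) mu la P1 Q1 = nwords R n tau la P Q.
Proof.
apply/eqP; rewrite eqn_leq; apply/andP; split.
  apply: (@nwords_le _ _ _ _ _ _ _ _ _ _ _ _ (drop ntop)) => //.
  - exact: top_le.
  - move=> w sz_w isw; rewrite size_drop sz_w addKn; split=> //.
    by apply: (greedy_word_inv _ isw).2; rewrite sz_w leq_addr.
  move=> w w' sz_w isw sz_w' isw' E.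
  have [|-> _] := greedy_word_inv _ isw; rewrite ?sz_w ?leq_addr //.
  by rewrite E; have [|<- _] := greedy_word_inv _ isw'; rewrite ?sz_w' ?leq_addr.
apply: (@nwords_le _ _ _ _ _ _ _ _ _ _ _ _ (cat top_word)) => //.
- exact: top_le.
- by move=> v sz_v isv; rewrite size_cat size_top_word sz_v; split=> //; apply: greedy_word.
by move=> v v' _ _ _ _ /eqP; rewrite eqseq_cat // eqxx => /eqP.
Qed.

End Pattern.

Lemma nwords_first_block n P Q m : m <= n -> ntop < m ->
  (forall i, 0 < i < m -> Q i = false) -> nwords R n mu la P Q = 0.
Proof.
move=> le_m lt_m Q0; apply/eqP; rewrite -leqn0 leqNgt; apply/negP.
move=> /(words_ex mu_la la_R)[w [sz_w isw]].
by move: (first_block isw Q0); rewrite sz_w => /(_ le_m); rewrite leqNgt lt_m.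
Qed.

End Greedy.

(** * Symmetry of Kostka numbers *)

(** The recursion makes deletion of the first part [x] a shift by [x], as [PQ_hi] requires. Both [0]
    and the total count as partial sums, but only positions strictly between them are tested. *)
Fixpoint psum (a : seq nat) i : bool :=
  (i == 0) || if a is x :: b then (x <= i) && psum b (i - x) else false.

Lemma psum0 a : psum a 0. Proof. by case: a. Qed.

Fixpoint blocks (a w : seq nat) : bool :=
  if a is x :: b then sorted geq (take x w) && blocks b (drop x w) else w == [::].

Lemma blocksP a w : size w = sumn a ->
  blocks a w <-> (forall i, 0 < i < size w -> ascent w i -> psum a i).
Proof.
elim: a w => [|x a IH] w /=; first by move=> /size0nil->; split=> // _ [].
move=> sz_w; set u := take x w; set v := drop x w.
have sz_u : size u = x by rewrite size_takel // sz_w leq_addr.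
have sz_v : size v = sumn a by rewrite size_drop sz_w addKn.
rewrite -(cat_take_drop x w) -/u -/v size_cat sz_u.
split=> [/andP[/sorted_ascent su /(IH _ sz_v) bv] i /andP[i0 lt_i] | H].
  apply/implyP; have [lt_x|lt_x|->] := ltngtP i x.
  - by rewrite ascent_catl ?sz_u // su // i0 sz_u.
  - have j0 : 0 < i - x by rewrite subn_gt0.
    rewrite -{1}(subnKC (ltnW lt_x)) -[X in ascent _ (X + _)]sz_u ascent_catr //.
    by apply/implyP => asc; rewrite bv ?orbT // j0 ltn_subLR // ltnW.
  by rewrite subnn psum0 ?leqnn orbT implybT.
apply/andP; split.
  apply/sorted_ascent => i /andP[i0]; rewrite sz_u => lt_x.
  apply/negP => asc; have := H i; rewrite ascent_catl ?sz_u // i0 (ltn_addr _ lt_x).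
  by move=> /(_ isT asc); rewrite leqNgt lt_x /= orbF eqn0Ngt i0.
apply/(IH _ sz_v) => i /andP[i0 lt_i] asc.
have := H (x + i); rewrite -[X in ascent _ (X + _)]sz_u ascent_catr // ltn_add2l lt_i addn_gt0 i0 orbT.
by move=> /(_ isT asc); rewrite addn_eq0 (gtn_eqF i0) andbF leq_addr addKn.
Qed.

Lemma blocks_cat a b u v : size u = sumn a ->
  blocks (a ++ b) (u ++ v) = blocks a u && blocks b v.
Proof.
elim: a u => [|x a IH] u /=; first by move=> /size0nil->.
move=> sz_u; have le_x : x <= size u by rewrite sz_u leq_addr.
rewrite takel_cat // drop_cat; case: ltngtP le_x => // [lt_x|Ex] _.
  by rewrite IH ?andbA // size_drop sz_u addKn.
have sa : size (Nil nat) = sumn a by apply/eqP; rewrite -(eqn_add2l x) -sz_u Ex addn0.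
by rewrite -Ex subnn drop0 [X in blocks a X]drop_oversize ?Ex // -andbA -IH.
Qed.

(** The entry [top f g i.+1] is the minimum of [g i.+1] and [f i], so it pairs with the maximum of
    the same two numbers; [top f g 0] is [g 0]. This identity makes the reflection below exchange
    the sizes of the two strips. *)
Lemma sum_top r (f g : nat -> nat) :
  \sum_(i < r) maxn (f i) (g i.+1) + \sum_(i < r.+1) top f g i
  = \sum_(i < r) f i + \sum_(i < r.+1) g i.
Proof.
elim: r => [|r IH]; first by rewrite !big_ord0 !big_ord1.
rewrite 2![in LHS]big_ord_recr [in RHS]big_ord_recr /= [X in _ = _ + X]big_ord_recr /=.
by rewrite addnACA [RHS]addnACA IH minnC [maxn _ _ + _]addnC addn_min_max.
Qed.

Section Flip.
Variables (R : nat) (ka : nat -> nat).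
Hypothesis ka_dec : noninc ka.
Implicit Types (u : seq nat) (x y : nat).

Definition two_blocks x y u :=
  [/\ size u = x + y, sorted geq (take x u), sorted geq (drop x u),
      lattice ka u & forall i, R <= i -> sh ka u i = 0].

(* If [u] adds two horizontal strips, from [ka] to [nu] and from [nu] to [rho],
   then [nu i] ranges over an interval depending only on [ka] and [rho], and
   the involution reflects every [nu i] in the middle of its interval. *)
Definition reflected x u i :=
  maxn (ka i) (sh ka u i.+1) + top ka (sh ka u) i - sh ka (take x u) i.

(** This is the Bender-Knuth involution. The word is rebuilt from its shapes alone, the two outer
    shapes being kept and the middle one reflected. *)
Definition flip x u :=
  dec_word R (fun i => reflected x u i - ka i)
  ++ dec_word R (fun i => sh ka u i - reflected x u i).

Section Fixed.
Variables (x y : nat) (u : seq nat).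
Hypothesis tb : two_blocks x y u.
Let rho := sh ka u.
Let nu := sh ka (take x u).

Let rho_nu : sh nu (drop x u) =1 rho.
Proof. by move=> i; rewrite /rho -{2}[u](cat_take_drop x) sh_cat. Qed.

Let nu_dec : noninc nu.
Proof. by case: tb => _ _ _ lat _; apply: lat. Qed.

(** The horizontal strip conditions for the two steps interlace [nu] with [ka] and [rho]. They bound
    each [nu i] separately, so the entries can be reflected independently. *)
Let nu_bounds i : maxn (ka i) (rho i.+1) <= nu i <= top ka rho i.
Proof.
have [_ s1 s2 lat _] := tb; move: lat; rewrite -[u](cat_take_drop x).
move=> /lattice_cat[/(lattice_sorted ka_dec s1) H1 /(lattice_sorted nu_dec s2) H2].
rewrite geq_max {1}/nu sh_le -rho_nu H2 /=.
by case: i => [|i] /=; rewrite -rho_nu ?leq_min sh_le // H1.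
Qed.

Let nu'_bounds i : maxn (ka i) (rho i.+1) <= reflected x u i <= top ka rho i.
Proof. by have := nu_bounds i; rewrite /reflected -/rho -/nu; lia. Qed.

Let ka_nu' i : ka i <= reflected x u i.
Proof. by have := nu'_bounds i; lia. Qed.

Let nu'_rho i : reflected x u i <= rho i.
Proof.
have /andP[_ /leq_trans] := nu'_bounds i; apply.
by case: i => //= i; apply: geq_minl.
Qed.

Let sh1 : sh ka (dec_word R (fun i => reflected x u i - ka i)) =1 reflected x u.
Proof.
move=> i; rewrite /sh count_dec_word; case: ltnP => [_|le_i].
  by rewrite subnKC.
have [_ _ _ _ rho0] := tb; have := nu'_rho i; have := ka_nu' i.
by rewrite /rho rho0 // addn0; lia.
Qed.

Let sh2 : sh ka (flip x u) =1 rho.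
Proof.
move=> i; rewrite sh_cat /sh -/(sh _ _ _) sh1 count_dec_word; case: ltnP => [_|le_i].
  by rewrite subnKC // nu'_rho.
have [_ _ _ _ rho0] := tb; have := nu'_rho i.
by rewrite /rho rho0 // addn0; lia.
Qed.

Let rho_R i : R <= i -> rho i = 0.
Proof. by case: tb => _ _ _ _; apply. Qed.

Let letters v : sh ka v =1 rho -> all (fun i => i < R) v.
Proof.
move=> Ev; apply/allP => i v_i; rewrite ltnNge; apply/negP => /rho_R.
rewrite -Ev => /eqP; rewrite addn_eq0 => /andP[_ /eqP/count_memPn/negP[]].
exact: v_i.
Qed.

Let size1 : size (dec_word R (fun i => reflected x u i - ka i)) = y.
Proof.
have [sz_u _ _ _ _] := tb.
have sz_r : size (drop x u) = y by rewrite size_drop sz_u addKn.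
have /size_count_mem : all (fun i => i < R) (drop x u).
  by have /allP H := @letters u (fun i => erefl); apply/allP => i /mem_drop/H.
rewrite sz_r => ->; rewrite size_dec_word.
(* Write [nu'] for the reflected shape. Summed over the rows, [nu + nu'] equals [ka + rho], since
   the terms at index [R] vanish; so [nu'/ka] has the size of [rho/nu], which is [y]. *)
have := sum_top R ka rho; rewrite [X in _ + X = _]big_ord_recr /= [X in _ = _ + X]big_ord_recr /=.
rewrite rho_R // addn0 (_ : top ka rho R = 0) ?addn0; last first.
  by case: {+}R rho_R => [|r] /= H; rewrite ?H // min0n.
rewrite -!big_split /= => E.
have E2 : \sum_(i < R) (reflected x u i - ka i + (ka i + nu i)) =
          \sum_(i < R) (count_mem (val i) (drop x u) + (ka i + nu i)).
  transitivity (\sum_(i < R) (maxn (ka i) (rho i.+1) + top ka rho i)).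
    apply: eq_bigr => i _; have := nu_bounds i; have := ka_nu' i.
    by rewrite /reflected -/rho -/nu; lia.
  rewrite E; apply: eq_bigr => i _; have -> : rho i = nu i + count_mem (val i) (drop x u) by rewrite -rho_nu.
    by rewrite addnA addnC.
by apply/eqP; rewrite -(eqn_add2r (\sum_(i < R) (ka i + nu i))) -!big_split E2.
Qed.

Lemma flip_two_blocks : two_blocks y x (flip x u).
Proof.
have [sz_u _ _ _ _] := tb.
split; rewrite ?take_size_cat ?drop_size_cat ?size1 ?dec_word_sorted //.
- have [/size_count_mem -> /size_count_mem] := (letters sh2, @letters u (fun i => erefl)).
  rewrite addnC -sz_u => ->; apply: eq_bigr => i _; apply/eqP.
  by rewrite -(eqn_add2l (ka i)) -[X in X == _]/(sh ka _ i) sh2.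
- have nu'_dec : noninc (reflected x u).
    move=> i; have := nu'_bounds i; have /= := nu'_bounds i.+1; lia.
  apply/lattice_cat; split.
    apply/lattice_sorted => //; first exact: dec_word_sorted.
    by move=> i; rewrite sh1; have /= := nu'_bounds i.+1; lia.
  apply: (@eq_lattice (reflected x u)) => [i|]; first by rewrite sh1.
  apply/lattice_sorted => //; first exact: dec_word_sorted.
  move=> i; have := sh2 i.+1; rewrite sh_cat /sh -/(sh _ _ _) sh1 => ->.
  by have := nu'_bounds i; lia.
by move=> i le_i; rewrite sh2 rho_R.
Qed.

Lemma sh_flip : sh ka (flip x u) =1 sh ka u.
Proof. exact: sh2. Qed.

(** The outer shapes are the same for [u] and [flip x u], so both reflections have the same
    centres. *)
Lemma flipK : flip y (flip x u) = u.
Proof.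
have [sz_u s1 s2 _ _] := tb.
have Enu i : reflected y (flip x u) i = nu i.
  rewrite /reflected take_size_cat ?size1 // sh1 sh_flip -/rho.
  have -> : top ka (sh ka (flip x u)) i = top ka rho i.
    by case: i => [|i] /=; rewrite sh_flip.
  by rewrite /reflected -/rho -/nu; have := nu_bounds i; lia.
rewrite -[RHS](cat_take_drop x); congr cat; apply: sorted_geq_eq => //.
- exact: dec_word_sorted.
- move=> i; rewrite count_dec_word Enu /nu /sh addKn; case: ltnP => // le_i.
  have := rho_R le_i.
  by rewrite -rho_nu /sh /nu /sh => /eqP; rewrite !addn_eq0 => /andP[/andP[_ /eqP->]].
- exact: dec_word_sorted.
move=> i; rewrite count_dec_word Enu sh_flip -/rho -rho_nu /sh addKn.
case: ltnP => // le_i; have := rho_R le_i.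
by rewrite -rho_nu /sh => /eqP; rewrite addn_eq0 => /andP[_ /eqP->].
Qed.

End Fixed.
End Flip.

Section Symmetry.
Variables (R : nat) (mu la : nat -> nat).
Hypotheses (mu_dec : noninc mu) (la_dec : noninc la).
Hypotheses (mu_la : forall i, mu i <= la i) (la_R : forall i, R <= i -> la i = 0).

Definition swap_blocks N x y (w : seq nat) :=
  take N w ++ flip R (sh mu (take N w)) x (take (x + y) (drop N w))
  ++ drop (x + y) (drop N w).

(** Standardization identifies semistandard tableaux of content [a] with standard ones whose
    descents are partial sums of [a], so this is the skew Kostka number. *)
Definition kostka a := nwords R (sumn a) mu la pred0 (psum a).

Lemma kostka_wordP a w : size w = sumn a ->
  is_word mu la pred0 (psum a) w <-> [/\ lattice mu w, sh mu w =1 la & blocks a w].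
Proof.
move=> sz_w; split=> [[? ? H] | [? ? /(blocksP sz_w) H]]; split=> //.
  by apply/(blocksP sz_w) => i /H[].
by move=> i H'; split=> //; apply: H.
Qed.

Lemma swap_blocks_word a b x y w : size w = sumn (a ++ x :: y :: b) ->
  is_word mu la pred0 (psum (a ++ x :: y :: b)) w ->
  [/\ size (swap_blocks (sumn a) x y w) = sumn (a ++ y :: x :: b),
      is_word mu la pred0 (psum (a ++ y :: x :: b)) (swap_blocks (sumn a) x y w)
    & swap_blocks (sumn a) y x (swap_blocks (sumn a) x y w) = w].
Proof.
move=> sz_w /(kostka_wordP sz_w)[lat Ela blk].
move: sz_w; rewrite sumn_cat /= => sz_w.
pose u1 := take (sumn a) w; pose u2 := take (x + y) (drop (sumn a) w).
pose u3 := drop (x + y) (drop (sumn a) w).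
have Ew : w = u1 ++ u2 ++ u3 by rewrite !cat_take_drop.
have sz1 : size u1 = sumn a by rewrite size_takel // sz_w leq_addr.
have sz2 : size u2 = x + y by rewrite size_takel // size_drop; lia.
have sz3 : size u3 = sumn b by rewrite !size_drop; lia.
move: lat Ela blk; rewrite Ew => lat Ela; rewrite blocks_cat // => /andP[blk1].
rewrite -[x :: y :: b]/([:: x; y] ++ b) blocks_cat /= ?addn0 // => /andP[].
move=> /and3P[s1 + _] blk3; rewrite take_oversize ?size_drop ?sz2 ?addKn // => s2.
move: lat => /lattice_cat[lat1 /lattice_cat[lat2 lat3]].
have tb : two_blocks R (sh mu u1) x y u2.
  split=> // i /la_R la0; apply/eqP.
  by rewrite -leqn0 -la0 -Ela !sh_cat sh_le.
have k_dec : noninc (sh mu u1) by apply: lattice_end.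
have [sz2' s1' s2' lat2' _] := flip_two_blocks k_dec tb.
have Esh := sh_flip k_dec tb.
have Eg : swap_blocks (sumn a) x y (u1 ++ u2 ++ u3) =
          u1 ++ flip R (sh mu u1) x u2 ++ u3.
  by rewrite /swap_blocks take_size_cat // drop_size_cat // take_size_cat // drop_size_cat.
have Eg' : swap_blocks (sumn a) y x (u1 ++ flip R (sh mu u1) x u2 ++ u3) =
           u1 ++ u2 ++ u3.
  rewrite /swap_blocks take_size_cat // drop_size_cat // take_size_cat // drop_size_cat //.
  by rewrite (flipK k_dec tb).
have sz_g : size (u1 ++ flip R (sh mu u1) x u2 ++ u3) = sumn (a ++ y :: x :: b).
  by rewrite size_cat sz1 [size (_ ++ u3)]size_cat sz2' sz3 sumn_cat /= -addnA.
rewrite Eg; split=> //; apply/kostka_wordP => //; split.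
- apply/lattice_cat; split=> //; apply/lattice_cat; split=> //.
  by apply: eq_lattice lat3 => i; rewrite Esh.
- move=> i; rewrite -Ela !sh_cat /sh; congr addn; exact: Esh.
rewrite blocks_cat // blk1 -[y :: x :: b]/([:: y; x] ++ b) blocks_cat /= ?addn0 //.
have sz_d : size (drop y (flip R (sh mu u1) x u2)) = x by rewrite size_drop sz2' addKn.
by rewrite s1' blk3 take_oversize ?sz_d // s2' drop_oversize ?sz_d.
Qed.

Lemma kostka_swap a b x y : kostka (a ++ x :: y :: b) = kostka (a ++ y :: x :: b).
Proof.
have le x' y' : kostka (a ++ x' :: y' :: b) <= kostka (a ++ y' :: x' :: b).
  apply: (@nwords_le _ _ _ _ _ _ _ _ _ _ _ _ (swap_blocks (sumn a) x' y')) => //.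
    by move=> w sz_w isw; have [] := swap_blocks_word sz_w isw.
  move=> w w' sz_w isw sz_w' isw' E.
  have [_ _ <-] := swap_blocks_word sz_w isw.
  by rewrite E; have [_ _ ->] := swap_blocks_word sz_w' isw'.
by apply/eqP; rewrite eqn_leq !le.
Qed.

End Symmetry.

(** * Skew shapes *)

Lemma eq_nwords R mu la mu' la' P Q P' Q' n :
  (forall i, mu i <= la i) -> (forall i, R <= i -> la i = 0) ->
  mu =1 mu' -> la =1 la' -> (forall i, 0 < i < n -> P i = P' i) ->
  (forall i, 0 < i < n -> Q i = Q' i) ->
  nwords R n mu la P Q = nwords R n mu' la' P' Q'.
Proof.
move=> mu_la la_R Emu Ela EP EQ.
have mu_la' i : mu' i <= la' i by rewrite -Emu -Ela.
have la_R' i : R <= i -> la' i = 0 by rewrite -Ela => /la_R.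
apply/eqP; rewrite eqn_leq; apply/andP; split; apply: (@nwords_le _ _ _ _ _ _ _ _ _ _ _ _ id) => //.
  move=> w sz_w [lat Ew Asc]; split=> //; split; first exact: eq_lattice lat.
    by move=> i; rewrite -Ela -Ew /sh Emu.
  by move=> i lt_i; rewrite -EP -?EQ -?sz_w //; apply: Asc.
move=> w sz_w [lat Ew Asc]; split=> //; split; first by apply: eq_lattice lat.
  by move=> i; rewrite Ela -Ew /sh Emu.
by move=> i lt_i; rewrite EP ?EQ -?sz_w //; apply: Asc.
Qed.

(** * Removing the first row of a straight shape *)

Section Straight.
Variables (R : nat) (l : nat -> nat).
Hypotheses (l_dec : noninc l) (l_R : forall i, R <= i -> l i = 0).
Let l' i := l i.+1.
Let zero (i : nat) := 0.

Let topS i : top zero l i.+1 = 0. Proof. exact: minn0. Qed.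

Let count_succ i (v : seq nat) : count_mem i.+1 (map S v) = count_mem i v.
Proof. by rewrite count_map; apply: eq_count => j /=; rewrite eqSS. Qed.

Let count_succ0 (v : seq nat) : count_mem 0 (map S v) = 0.
Proof. by apply/count_memPn/mapP => - []. Qed.

(** After peeling, row [0] of a straight shape is complete and the other rows are empty. What
    remains to be filled is [l'] moved down by one row, whence the shift of the letters. *)
Let behead_wordP P Q v :
  is_word (top zero l) l P Q (map S v) <-> is_word zero l' P Q v.
Proof.
have Asc : (forall i, 0 < i < size (map S v) ->
             (P i -> ascent (map S v) i) /\ (ascent (map S v) i -> Q i)) <->
           (forall i, 0 < i < size v -> (P i -> ascent v i) /\ (ascent v i -> Q i)).
  rewrite size_map; have E i : 0 < i < size v -> ascent (map S v) i = ascent v i.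
    move=> /andP[i0 lt_i]; rewrite /ascent !(nth_map 0) ?ltnS //.
    by rewrite (leq_ltn_trans (leq_pred i)).
  by split=> H i lt_i; have := H i lt_i; rewrite E.
split=> [[lat El /Asc H] | [lat El H]]; split=> //.
- move=> k i; have := lat k i.+1.
  by rewrite -map_take /sh !topS !count_succ.
- by move=> i; rewrite /l' -El /sh topS count_succ.
(* Row [0] already has its full length, so between rows [0] and [1] the condition follows from
   [l 1 <= l 0]. *)
- move=> k [|i]; rewrite -map_take /sh ?topS ?count_succ ?count_succ0.
    rewrite addn0 /=; apply: leq_trans (l_dec 0); rewrite -[l 1]El.
    exact: (sh_take_le zero k v 0).
  by have := lat k i.
- move=> [|i]; rewrite /sh ?topS ?count_succ ?count_succ0 ?addn0 //; exact: El.
exact/Asc.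
Qed.

Lemma ntop_straight : ntop R zero l = l 0.
Proof.
rewrite /ntop; case: R l_R => [|r] l_r; first by rewrite big_ord0 l_r.
by rewrite big_ord_recl big1 ?addn0 /= ?subn0 // => i _; rewrite minn0.
Qed.

Lemma nwords_behead n P Q :
  nwords R n (top zero l) l P Q = nwords R.-1 n zero l' P Q.
Proof.
have l_R' i : R.-1 <= i -> l' i = 0 by move=> le_i; apply: l_R; lia.
have le_l i : top zero l i <= l i by apply: top_le.
apply/eqP; rewrite eqn_leq; apply/andP; split.
  have predK w : is_word (top zero l) l P Q w -> map S (map predn w) = w.
    case=> _ El _; rewrite -map_comp map_id_in // => x /= w_x.
    rewrite prednK // lt0n; apply/eqP => x0; have := El 0.
    rewrite -[RHS]addn0 /sh => /addnI /count_memPn/negP[].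
    by rewrite -x0.
  apply: (@nwords_le _ _ _ _ _ _ _ _ _ _ _ _ (map predn)) => //.
    move=> w sz_w isw; rewrite size_map sz_w; split=> //.
    by apply/behead_wordP; rewrite predK.
  by move=> w w' _ /predK {2}<- _ /predK {2}<- ->.
apply: (@nwords_le _ _ _ _ _ _ _ _ _ _ _ _ (map S)) => //.
  by move=> v sz_v isv; rewrite size_map sz_v; split=> //; apply/behead_wordP.
by move=> v v' _ _ _ _ /inj_map; apply; apply: succn_inj.
Qed.

End Straight.

Lemma part_of_subproof R g : noninc g -> is_part [seq x <- mkseq g R | x != 0].
Proof.
move=> g_dec; rewrite /is_part mem_filter eqxx andbT.
have tr : transitive geq by move=> a b c /= ? /leq_trans; apply.
apply: (sorted_filter tr); apply/(sortedP 0) => i; rewrite size_mkseq => lt_i /=.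
by rewrite !nth_mkseq // ltnW.
Qed.

Definition part_of R g (g_dec : noninc g) : intpart :=
  IntPart (part_of_subproof R g_dec).

Lemma nth_part_of R g (g_dec : noninc g) i :
  (forall i, R <= i -> g i = 0) -> nth 0 (part_of R g_dec) i = g i.
Proof.
move=> g_R; have tr : transitive geq by move=> a b c /= ? /leq_trans; apply.
(* The zeros of a weakly decreasing sequence stand at its end, where [nth] returns the default [0]
   anyway. *)
have nth_filter s : sorted geq s -> nth 0 [seq x <- s | x != 0] i = nth 0 s i.
  elim: s i => //= x s IH i x_s; have s_s := path_sorted x_s.
  case: eqP => [x0 | _]; last by case: i => //= i; rewrite IH.
  have s0 y : y \in s -> y = 0.
    by move=> /(allP (order_path_min tr x_s)) /=; rewrite x0 leqn0 => /eqP.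
  rewrite (@eq_in_filter _ _ pred0) => [|y /s0-> //]; rewrite filter_pred0 nth_nil.
  case: i => [|i] //=; have [lt_i|le_i] := ltnP i (size s); last by rewrite nth_default.
  by rewrite (s0 (nth 0 s i)) // mem_nth.
rewrite /= nth_filter; last first.
  apply/(sortedP 0) => j; rewrite size_mkseq => lt_j /=.
  by rewrite !nth_mkseq // ltnW.
have [lt_i|le_i] := ltnP i R; first by rewrite nth_mkseq.
by rewrite nth_default ?size_mkseq // g_R.
Qed.

Lemma part_inj (l m : intpart) : nth 0 l =1 nth 0 m -> l = m.
Proof.
have le (s t : intpart) : nth 0 s =1 nth 0 t -> size s <= size t.
  case: s => s /= /andP[_ s0] E; rewrite leqNgt; apply/negP => lt_t.
  move/negP: s0; apply; have := E (size t); rewrite [RHS]nth_default // => <-.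
  by rewrite mem_nth.
move=> E; apply: val_inj; apply: (@eq_from_nth _ 0) => [|i _]; last exact: E.
by apply/eqP; rewrite eqn_leq !le // => i; rewrite E.
Qed.

Lemma nth_part_dec (l : intpart) : noninc (nth 0 l).
Proof.
case: l => s /= /andP[/(sortedP 0) s_dec _] i.
have [lt_i|le_i] := ltnP i.+1 (size s); first exact: s_dec.
by rewrite [X in X <= _]nth_default.
Qed.

Definition inn (A : skew_shape) := nth 0 (inner A).
Definition out (A : skew_shape) := nth 0 (outer A).

Lemma inn_dec A : noninc (inn A). Proof. exact: nth_part_dec. Qed.
Lemma out_dec A : noninc (out A). Proof. exact: nth_part_dec. Qed.
Lemma inn_out A i : inn A i <= out A i. Proof. by case: A => ? ? H; apply: H. Qed.
Lemma out_nrows A i : nrows A <= i -> out A i = 0.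
Proof. exact: nth_default. Qed.
#[local] Hint Resolve inn_dec out_dec inn_out : core.

Definition syt (A : skew_shape) n P Q := nwords (nrows A) n (inn A) (out A) P Q.
Definition kost (A : skew_shape) := kostka (nrows A) (inn A) (out A).
(** The number of nonempty columns, as opposed to [ncols], the width of the outer partition. *)
Definition ncol (A : skew_shape) := ntop (nrows A) (inn A) (out A).

Lemma peel_top_dec A : noninc (top (inn A) (out A)).
Proof. exact: top_dec. Qed.

Lemma nth_peel A i : nth 0 (part_of (nrows A) (@peel_top_dec A)) i = top (inn A) (out A) i.
Proof.
apply: nth_part_of => j le_j; apply/eqP; rewrite -leqn0 -(out_nrows le_j).
exact: top_le.
Qed.

Lemma peel_subproof A i :
  nth 0 (part_of (nrows A) (@peel_top_dec A)) i <= nth 0 (outer A) i.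
Proof. by rewrite nth_peel top_le. Qed.

(* [A] with the top box of each of its columns removed. *)
Definition peel A := SkewShape (@peel_subproof A).

Lemma in_peel0 A j : in_shape (peel A) 0 j = false.
Proof. by rewrite /in_shape /= nth_peel /=; case: leqP => //; rewrite leqNgt => /negbTE. Qed.

Lemma in_peelS A i j :
  in_shape (peel A) i.+1 j = in_shape A i j && in_shape A i.+1 j.
Proof.
rewrite /in_shape [inner _]/= nth_peel /= -!/(inn _ _) -!/(out _ _).
by have := inn_dec A i; have := out_dec A i; lia.
Qed.

Section Peel.
Variables (A : skew_shape) (n : nat) (P1 Q1 P Q : pred nat).
Hypothesis (PQ_lo : forall i, 0 < i < ncol A -> P1 i = false /\ Q1 i = false).
Hypothesis (PQ_eq : 0 < ncol A -> Q1 (ncol A)).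
Hypothesis (PQ_hi : forall i, 0 < i -> P1 (ncol A + i) = P i /\ Q1 (ncol A + i) = Q i).

Lemma syt_peel : syt A (ncol A + n) P1 Q1 = syt (peel A) n P Q.
Proof.
rewrite /syt (nwords_greedy (@inn_dec A) (@inn_out A) (@out_nrows A) PQ_lo PQ_eq PQ_hi).
apply: eq_nwords => // i; [exact: top_le | exact: out_nrows | exact/esym/nth_peel].
Qed.
End Peel.

Lemma syt_ncol A n P Q m : m <= n -> ncol A < m ->
  (forall i, 0 < i < m -> Q i = false) -> syt A n P Q = 0.
Proof. by apply: nwords_first_block => // i; apply: out_nrows. Qed.

Lemma behead_part_subproof (l : intpart) : is_part (behead l).
Proof.
case: l => [[|x s]] //= /andP[/path_sorted s_s]; rewrite /is_part s_s inE negb_or.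
by case/andP.
Qed.

Definition behead_part l := IntPart (behead_part_subproof l).

Lemma ncol_straight l : ncol (straight l) = head 0 l.
Proof.
rewrite -nth0; apply: etrans (ntop_straight (l := nth 0 l) _); last exact: nth_default.
by apply: eq_bigr => i _; case: {+}i => [[|j] H] //=; rewrite /inn /= ?nth_nil.
Qed.

Lemma syt_peel_straight l n P Q :
  syt (peel (straight l)) n P Q = syt (straight (behead_part l)) n P Q.
Proof.
have l_R i : nrows (straight l) <= i -> nth 0 l i = 0 by apply: nth_default.
transitivity (nwords (nrows (straight l)) n (top (fun=> 0) (nth 0 l)) (nth 0 l) P Q).
  apply: eq_nwords => // i; apply: etrans (nth_peel _ _) _.
  by case: i => [|i] //=; rewrite /inn /= nth_nil.
rewrite nwords_behead //; last exact: nth_part_dec.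
have -> : (nrows (straight l)).-1 = nrows (straight (behead_part l)).
  by rewrite /nrows /= size_behead.
apply: eq_nwords => // i.
- by rewrite /nrows /= size_behead => le_i; apply: nth_default; lia.
- by rewrite /inn /= nth_nil.
by rewrite /out /= nth_behead.
Qed.

(** * Tableaux and words *)

Lemma in_shape_row A i j : in_shape A i j -> i < nrows A.
Proof.
case/andP=> _; rewrite ltnNge => H; rewrite ltnNge; apply: contra H.
by move=> /(nth_default 0) ->.
Qed.

Lemma in_shape_col A i j : in_shape A i j -> j < ncols A.
Proof.
case/andP=> _ lt_j; rewrite /ncols -nth0; apply: leq_trans lt_j _.
exact: noninc_le (out_dec A) _.
Qed.

Lemma card_ltS (T : finType) (f : T -> nat) (p : pred T) x k :
  injective f -> f x = k ->
  #|[pred y | p y & f y < k.+1]| = #|[pred y | p y & f y < k]| + p x.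
Proof.
move=> f_inj Ex; rewrite (cardD1 x) !inE Ex ltnSn andbT addnC; congr addn.
apply: eq_card => y; rewrite !inE ltnS [_ <= k]leq_eqVlt.
have [-> | ne_yx] := eqVneq y x; first by rewrite Ex ltnn andbF.
by rewrite -Ex (inj_eq f_inj) (negbTE ne_yx).
Qed.

Section Boxes.
Variable A : skew_shape.

Definition mkbox i j (H : in_shape A i j) : box A :=
  exist (fun x : 'I_(nrows A) * 'I_(ncols A) => in_shape A x.1 x.2)
    (Ordinal (in_shape_row H), Ordinal (in_shape_col H)) H.

Lemma mkbox_row i j (H : in_shape A i j) : box_row (mkbox H) = i.
Proof. by []. Qed.

Lemma mkbox_col i j (H : in_shape A i j) : box_col (mkbox H) = j.
Proof. by []. Qed.

Lemma box_in (x : box A) : in_shape A (box_row x) (box_col x).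
Proof. exact: valP x. Qed.

Lemma box_bounds (x : box A) : inn A (box_row x) <= box_col x < out A (box_row x).
Proof. exact: valP x. Qed.

Lemma box_inj (x y : box A) : box_row x = box_row y -> box_col x = box_col y -> x = y.
Proof.
case: x y => [[i j] Hx] [[i' j'] Hy]; rewrite /box_row /box_col /= => Ei Ej.
by apply: val_inj => /=; congr pair; apply: val_inj.
Qed.

Lemma card_row i j : j <= out A i ->
  #|[pred x : box A | (box_row x == i) && (box_col x < j)]| = j - inn A i.
Proof.
move=> le_j; rewrite cardE -(size_map (@box_col A)) -[RHS](size_iota (inn A i)).
apply/perm_size/uniq_perm; rewrite ?iota_uniq //.
  rewrite map_inj_in_uniq ?enum_uniq // => x y; rewrite !mem_enum !inE.
  by move=> /andP[/eqP Ex _] /andP[/eqP Ey _]; apply: box_inj; rewrite Ex.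
move=> c; rewrite mem_iota; apply/mapP/idP => [[x] | /andP[le_c lt_c]].
  rewrite mem_enum !inE => /andP[/eqP Ex lt_x] ->.
  by have /andP[] := box_in x; rewrite Ex -/(inn A i); lia.
have H : in_shape A i c by rewrite /in_shape -/(inn A i) -/(out A i); lia.
by exists (mkbox H); rewrite // mem_enum !inE mkbox_row mkbox_col eqxx; lia.
Qed.

Definition row_word (T : filling A) : seq nat :=
  mkseq (fun k => if [pick x | T x == k :> nat] is Some x then box_row x else 0)
    (nboxes A).

Lemma size_row_word T : size (row_word T) = nboxes A.
Proof. exact: size_mkseq. Qed.

Lemma SYT_P (T : filling A) : reflect
  [/\ injective T,
      forall x y, box_row x = box_row y -> box_col x < box_col y -> T x < T y
    & forall x y, box_col x = box_col y -> box_row x < box_row y -> T x < T y]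
  (is_SYT T).
Proof.
apply: (iffP and3P) => [[/injectiveP ? /forallP H1 /forallP H2] | [? H1 H2]]; split=> //.
- move=> x y Exy lt_xy; have /forallP/(_ y)/implyP := H1 x.
  by rewrite Exy eqxx lt_xy => /(_ isT).
- move=> x y Exy lt_xy; have /forallP/(_ y)/implyP := H2 x.
  by rewrite Exy eqxx lt_xy => /(_ isT).
- exact/injectiveP.
- by apply/forallP => x; apply/forallP => y; apply/implyP => /andP[/eqP ? ?]; apply: H1.
by apply/forallP => x; apply/forallP => y; apply/implyP => /andP[/eqP ? ?]; apply: H2.
Qed.

Lemma inj_onto (T : filling A) k : injective T -> k < nboxes A ->
  exists x, T x = k :> nat.
Proof.
move=> T_inj lt_k; have /codomP[x Ex] : Ordinal lt_k \in codom T.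
  by apply: (inj_card_onto T_inj); rewrite card_ord.
by exists x; rewrite -Ex.
Qed.

Lemma nth_row_word (T : filling A) x : injective T ->
  nth 0 (row_word T) (T x) = box_row x.
Proof.
move=> T_inj; rewrite nth_mkseq //; case: pickP => [y /eqP/val_inj/T_inj -> //|].
by move=> /(_ x); rewrite eqxx.
Qed.

Lemma count_row_word (T : filling A) i k : injective T -> k <= nboxes A ->
  count_mem i (take k (row_word T)) = #|[pred x | (box_row x == i) && (T x < k)]|.
Proof.
move=> T_inj; elim: k => [|k IH] lt_k.
  by rewrite take0 eq_card0 // => x; rewrite !inE ltn0 andbF.
have [x Ex] := inj_onto T_inj lt_k.
rewrite (take_nth 0) ?size_row_word // -cats1 count_cat IH 1?ltnW //=.
rewrite -{2}Ex nth_row_word // addn0.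
exact/esym/(@card_ltS _ (fun y => T y) (fun y => box_row y == i) x k (inj_comp val_inj T_inj) Ex).
Qed.

(* The characteristic property of the word of [T]; both directions of the
   correspondence between tableaux and words are deduced from it. *)
Lemma SYT_shape T k x : is_SYT T -> k <= nboxes A ->
  (T x < k) = (box_col x < sh (inn A) (take k (row_word T)) (box_row x)).
Proof.
move=> /SYT_P[T_inj T_row _] le_k; rewrite /sh count_row_word //.
have /andP[le_x lt_x] := box_bounds x.
have [lt_T|le_T] := ltnP (T x) k.
  rewrite -ltn_subLR // -subSn // -card_row //; apply/esym/subset_leq_card/subsetP => y.
  rewrite !inE ltnS => /andP[/eqP Ey le_y]; rewrite Ey eqxx /=.
  apply: leq_ltn_trans lt_T; move: le_y; rewrite leq_eqVlt => /predU1P[E|].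
    by rewrite (box_inj Ey E).
  by move/(T_row _ _ Ey)/ltnW.
apply/esym/negbTE; rewrite -leqNgt -leq_subRL // -card_row; last exact: ltnW.
apply/subset_leq_card/subsetP => y; rewrite !inE => /andP[/eqP Ey lt_y].
rewrite Ey eqxx /= ltnNge leq_eqVlt; apply/negP => /predU1P[E|].
  by move: lt_y; rewrite -(box_inj (esym Ey) E) ltnNge le_T.
by move/(T_row _ _ (esym Ey)); rewrite ltnNge ltnW // (leq_trans lt_y).
Qed.

Lemma SYT_word T : is_SYT T ->
  lattice (inn A) (row_word T) /\ sh (inn A) (row_word T) =1 out A.
Proof.
move=> sT; have [T_inj _ T_col] := SYT_P _ sT.
have Eout : sh (inn A) (row_word T) =1 out A.
  move=> i; rewrite /sh -{1}[row_word T]take_size count_row_word ?size_row_word //.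
  rewrite -[RHS](subnKC (inn_out A i)) -(@card_row i (out A i)) //; congr addn.
  apply: eq_card => x; rewrite !inE ltn_ord; case: eqP => // Ex.
  by have /andP[_] := box_in x; rewrite Ex => ->.
split=> // k i; wlog le_k : k / k <= nboxes A => [H|].
  have [/H//|lt_k] := leqP k (nboxes A).
  have -> : take k (row_word T) = take (nboxes A) (row_word T).
    by rewrite !take_oversize // size_row_word // ltnW.
  exact: H.
(* If row [i.+1] were longer, its box in column [j] would be filled within the first [k] steps and
   the box above it would not, although columns increase. *)
rewrite leqNgt; apply/negP; set j := sh _ _ i => lt_j.
have lt_j' : j < out A i.+1.
  by rewrite -Eout; apply: leq_trans lt_j (sh_take_le _ _ _ _).
have le_j : inn A i <= j by apply: sh_le.
have Hx : in_shape A i j.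
  by rewrite /in_shape -/(inn A i) le_j -/(out A i) (leq_trans lt_j') ?out_dec.
have Hy : in_shape A i.+1 j.
  by rewrite /in_shape -/(inn A i.+1) -/(out A i.+1) lt_j' (leq_trans _ le_j) ?inn_dec.
have : T (mkbox Hy) < k by rewrite SYT_shape // mkbox_row mkbox_col.
rewrite ltnNge => /negP[]; apply: leq_trans (ltnW (T_col (mkbox Hx) (mkbox Hy) _ _)) => //.
by rewrite leqNgt SYT_shape // mkbox_row mkbox_col -/j ltnn.
Qed.

Lemma row_word_inj T T' : is_SYT T -> is_SYT T' -> row_word T = row_word T' -> T = T'.
Proof.
move=> sT sT' E; apply/ffunP => x; apply: val_inj.
have le (S S' : filling A) : is_SYT S -> is_SYT S' -> row_word S = row_word S' ->
    S x <= S' x.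
  by move=> sS sS' ES; rewrite -ltnS (SYT_shape x sS) // ES -(SYT_shape x sS').
by apply/eqP; rewrite eqn_leq !le.
Qed.

Lemma SYT_of_word w : size w = nboxes A -> lattice (inn A) w ->
  sh (inn A) w =1 out A -> exists2 T, is_SYT T & row_word T = w.
Proof.
move=> sz_w lat Ew.
(* The box [x] receives the first index at which the growing shape contains it. *)
pose p (x : box A) k := box_col x < sh (inn A) (take k.+1 w) (box_row x).
have p_ex (x : box A) : has (p x) (iota 0 (nboxes A)).
  have n0 : 0 < nboxes A by apply/card_gt0P; exists x.
  apply/hasP; exists (nboxes A).-1; first by rewrite mem_iota /= add0n prednK.
  rewrite /p prednK // -sz_w take_size Ew.
  by have /andP[] := box_in x.
have p_find (x : box A) : find (p x) (iota 0 (nboxes A)) < nboxes A.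
  by rewrite -[X in _ < X](size_iota 0) -has_find.
pose T : filling A := [ffun x => Ordinal (p_find x)].
have Tlt x k : k <= nboxes A ->
    (T x < k) = (box_col x < sh (inn A) (take k w) (box_row x)).
  move=> le_k; rewrite ffunE /=; apply/idP/idP => [lt_k | lt_c].
    have := nth_find 0 (p_ex x); rewrite nth_iota // add0n /p => /leq_trans -> //.
    by rewrite -(take_takel w lt_k); apply: sh_take_le.
  case: k le_k lt_c => [|k] lt_k lt_c.
    by move: lt_c; rewrite take0 /sh addn0 ltnNge => /negP[]; case/andP: (box_in x).
  rewrite ltnNge; apply/negP => /(before_find 0); rewrite nth_iota // add0n.
  by rewrite /p lt_c.
have Tsh x : [/\ nth 0 w (T x) = box_row x
               & sh (inn A) (take (T x) w) (box_row x) = box_col x].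
  have H1 := Tlt x (T x) (ltnW (ltn_ord _)); have H2 := Tlt x (T x).+1 (ltn_ord _).
  move: H2; rewrite ltnSn (take_nth 0) ?sz_w // -cats1 sh_cat {1}/sh /= addn0.
  move: H1; rewrite ltnn => /esym/negbT; rewrite -leqNgt => le1 /esym.
  case: eqP => [-> | _]; last by rewrite addn0 ltnNge le1.
  by rewrite addn1 ltnS => le2; split=> //; apply/eqP; rewrite eqn_leq le1.
have T_inj : injective T.
  move=> x y E; have [rx cx] := Tsh x; have [ry cy] := Tsh y.
  have Er : box_row x = box_row y by rewrite -rx -ry E.
  by apply: box_inj; rewrite // -cx -cy Er E.
have sT : is_SYT T.
  apply/SYT_P; split=> // x y Exy lt_xy.
    rewrite Tlt; last exact: ltnW.
    by have [_ cy] := Tsh y; rewrite Exy cy.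
  (* The row of [x] is higher and hence at least as long at every stage, so [x] is filled no later
     than [y]; injectivity excludes equality. *)
  have : T x < (T y).+1.
    rewrite Tlt // Exy; apply: leq_trans (noninc_le (lat _) (ltnW lt_xy)).
    by rewrite -Tlt.
  rewrite ltnS leq_eqVlt => /predU1P[/val_inj/T_inj E|//].
  by move: lt_xy; rewrite E ltnn.
exists T => //; apply: (@eq_from_nth _ 0); rewrite size_row_word ?sz_w // => k lt_k.
have [x Ex] := inj_onto T_inj lt_k; rewrite -Ex nth_row_word //.
by case: (Tsh x).
Qed.

Definition sytab P Q : {set filling A} := [set T | is_SYT T &
  [forall i : 'I_(nboxes A), (0 < i) ==>
     (P (val i) ==> ascent (row_word T) i) && (ascent (row_word T) i ==> Q (val i))]].

Lemma sytabP P Q T :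
  T \in sytab P Q <-> is_SYT T /\ is_word (inn A) (out A) P Q (row_word T).
Proof.
rewrite inE; split=> [/andP[sT /forallP H] | [sT [_ _ H]]].
  split=> //; have [? ?] := SYT_word sT; split=> // i; rewrite size_row_word.
  move=> /andP[i0 lt_i]; have := H (Ordinal lt_i); rewrite i0 /=.
  by case/andP=> /implyP ? /implyP ?.
rewrite sT; apply/forallP => i; apply/implyP => i0; have [|? ?] := H i.
  by rewrite i0 size_row_word ltn_ord.
by apply/andP; split; apply/implyP.
Qed.

Lemma card_sytab P Q : #|sytab P Q| = syt A (nboxes A) P Q.
Proof.
have la_R := @out_nrows A; have mu_la := @inn_out A.
rewrite cardE /syt /nwords -size_filter; apply/eqP; rewrite eqn_leq; apply/andP; split.
  apply: (@size_le_inj _ _ _ _ row_word) => [|T|T T']; rewrite ?enum_uniq ?mem_enum //.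
    move=> /sytabP[_ isw]; apply/mem_words => //.
    by rewrite size_row_word.
  by move=> /sytabP[sT _] /sytabP[sT' _]; apply: row_word_inj.
rewrite -(size_map row_word); apply: uniq_leq_size.
  by rewrite filter_uniq ?all_words_uniq.
move=> w /mem_words[] // sz_w isw; have [lat Ew _] := isw.
have [T sT ET] := SYT_of_word sz_w lat Ew.
by apply/mapP; exists T; rewrite // mem_enum; apply/sytabP; rewrite ET.
Qed.

Lemma mem_descent_set T (i : 'I_(nboxes A)) : is_SYT T ->
  (i \in descent_set T) = (0 < i) && ascent (row_word T) i.
Proof.
move=> /SYT_P[T_inj _ _]; rewrite inE.
apply/idP/idP => [/existsP[x /existsP[y /and3P[/eqP Ex /eqP[Ey] lt_xy]]] | /andP[i0]].
  apply/andP; split; first by rewrite -Ex.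
  have Ex' : i.-1 = T x :> nat by rewrite -Ex.
  have Ey' : i = T y :> nat by rewrite -Ey.
  by rewrite /ascent Ex' Ey' !nth_row_word.
have [x Ex] := inj_onto T_inj (leq_ltn_trans (leq_pred i) (ltn_ord i)).
have [y Ey] := inj_onto T_inj (ltn_ord i).
rewrite /ascent -Ex -Ey !nth_row_word // => lt_xy.
apply/existsP; exists x; apply/existsP; exists y.
by rewrite lt_xy /entry Ex Ey prednK // !eqxx.
Qed.

End Boxes.

(** * Transposing standard tableaux *)

Section Transpose.
Variables A B : skew_shape.
Hypothesis AB : forall i j, in_shape A i j = in_shape B j i.

Let AB_box (x : box A) : in_shape B (box_col x) (box_row x).
Proof. by rewrite -AB box_in. Qed.

Definition tr_box x : box B := mkbox (AB_box x).

Lemma tr_box_inj : injective tr_box.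
Proof.
by move=> x y /[dup] /(congr1 (@box_row B)) ? /(congr1 (@box_col B)) ?; apply: box_inj.
Qed.

Lemma nboxes_tr_le : nboxes A <= nboxes B.
Proof. exact: leq_card tr_box_inj. Qed.

(** If [y] were both strictly below and strictly to the right of [x], the corner in the row of [x]
    and the column of [y] would hold an entry strictly between two consecutive ones. If it were
    neither, the corner in the row of [y] and the column of [x] would give [T y <= T x]. *)
Lemma SYT_consecutive (T : filling A) x y : is_SYT T -> T y = (T x).+1 :> nat ->
  (box_row x < box_row y) = ~~ (box_col x < box_col y).
Proof.
move=> /SYT_P[_ T_row T_col] Exy.
have /andP[ix ox] := box_bounds x; have /andP[iy oy] := box_bounds y.
have [lt_r|le_r] := ltnP (box_row x) (box_row y).
  apply/esym/negP => lt_c.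
  have Hz : in_shape A (box_row x) (box_col y).
    have := noninc_le (@out_dec A) (ltnW lt_r).
    by rewrite /in_shape -/(inn A _) -/(out A _); lia.
  have := T_row x (mkbox Hz) erefl lt_c; have := T_col (mkbox Hz) y erefl lt_r.
  by rewrite Exy; lia.
apply/esym/negbF; rewrite ltnNge; apply/negP => le_c.
have Hz : in_shape A (box_row y) (box_col x).
  have := noninc_le (@out_dec A) le_r.
  by rewrite /in_shape -/(inn A _) -/(out A _); lia.
have : T y <= T (mkbox Hz).
  move: le_c; rewrite leq_eqVlt => /predU1P[E|]; last by move/(T_row y (mkbox Hz) erefl)/ltnW.
  by have -> : mkbox Hz = y by apply: box_inj.
have : T (mkbox Hz) <= T x.
  move: le_r; rewrite leq_eqVlt => /predU1P[E|]; last by move/(T_col (mkbox Hz) x erefl)/ltnW.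
  by have -> : mkbox Hz = x by apply: box_inj.
by rewrite Exy; lia.
Qed.

End Transpose.

Section Transpose2.
Variables A B : skew_shape.
Hypothesis AB : forall i j, in_shape A i j = in_shape B j i.
Let BA i j : in_shape B i j = in_shape A j i. Proof. by rewrite AB. Qed.

Lemma nboxes_tr : nboxes A = nboxes B.
Proof. by apply/eqP; rewrite eqn_leq !nboxes_tr_le. Qed.

Definition tr_filling (T : filling A) : filling B :=
  [ffun y => cast_ord nboxes_tr (T (tr_box BA y))].

Lemma tr_filling_SYT T : is_SYT T -> is_SYT (tr_filling T).
Proof.
move=> /SYT_P[T_inj T_row T_col]; apply/SYT_P; split=> [x y|x y E lt|x y E lt].
- by rewrite !ffunE => /cast_ord_inj/T_inj/tr_box_inj.
- by rewrite !ffunE; apply: T_col.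
by rewrite !ffunE; apply: T_row.
Qed.

Lemma tr_filling_ascent T i : is_SYT T -> 0 < i < nboxes A ->
  ascent (row_word (tr_filling T)) i = ~~ ascent (row_word T) i.
Proof.
move=> sT /andP[i0 lt_i]; have sT' := tr_filling_SYT sT.
have [T_inj _ _] := SYT_P _ sT; have [T_inj' _ _] := SYT_P _ sT'.
have [|x Ex] := @inj_onto _ (tr_filling T) i.-1 T_inj'.
  by rewrite -nboxes_tr (leq_ltn_trans (leq_pred i)).
have [|y Ey] := @inj_onto _ (tr_filling T) i T_inj'; first by rewrite -nboxes_tr.
rewrite /ascent -{1}Ex -{1}Ey !nth_row_word //.
rewrite !ffunE /= in Ex Ey; rewrite -Ex -Ey !nth_row_word //.
by rewrite (SYT_consecutive sT) ?negbK // Ex Ey prednK.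
Qed.

Lemma syt_tr_le P :
  syt A (nboxes A) P P <= syt B (nboxes A) (predC P) (predC P).
Proof.
rewrite [in X in _ <= X]nboxes_tr -!card_sytab !cardE.
apply: (@size_le_inj _ _ _ _ tr_filling) => [|T|T T' _ _ E]; rewrite ?enum_uniq ?mem_enum //.
  move=> /sytabP[sT [_ _ Asc]]; have sT' := tr_filling_SYT sT.
  apply/sytabP; split=> //; have [? ?] := SYT_word sT'; split=> // i.
  rewrite size_row_word -nboxes_tr => lt_i; rewrite tr_filling_ascent //=.
  have [|H1 H2] := Asc i; first by rewrite size_row_word.
  by split; [apply: contra H2 | apply: contra H1].
apply/ffunP => x; have := congr1 (fun S : filling B => S (tr_box AB x)) E.
rewrite !ffunE => /cast_ord_inj; suff -> : tr_box BA (tr_box AB x) = x by [].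
exact: box_inj.
Qed.

End Transpose2.

(** * Monomial coefficients of skew Schur functions *)

(** Inclusion-exclusion: additivity expresses [h (predU1 k P) Q] as the difference of [h P Q] and
    [h P (predD1 Q k)], so every value reduces to values with empty lower bound. *)
Lemma interval_inversion n (h : pred nat -> pred nat -> int) :
  (forall P P' Q Q', (forall i, 0 < i < n -> P i = P' i) ->
     (forall i, 0 < i < n -> Q i = Q' i) -> h P Q = h P' Q') ->
  (forall (P Q : pred nat) i, 0 < i < n -> ~~ P i -> Q i ->
     h P Q = (h (predU1 i P) Q + h P (predD1 Q i))%R) ->
  (forall Q, h pred0 Q = 0%R) ->
  forall P Q : pred nat, (forall i, 0 < i < n -> P i -> Q i) -> h P Q = 0%R.
Proof.
(* The relevant elements of [P] are less than [k]; each induction step removes the greatest one. *)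
move=> h_ext h_add h0 P Q; move: {2}n (leqnn n) => k le_k.
have : forall i, k <= i -> 0 < i < n -> P i = false by lia.
elim: k P Q {le_k} => [|k IH] P Q P0 PQ.
  by rewrite -(h0 Q); apply: h_ext => // i /P0->.
have [Pk|/negbTE Pk] := boolP ((0 < k < n) && P k); last first.
  apply: IH => // i; rewrite leq_eqVlt => /predU1P[<- lt_i|/P0//].
  by rewrite lt_i in Pk.
case/andP: Pk => lt_k Pk; pose P' : pred nat := predD1 P k.
have P'0 i : k <= i -> 0 < i < n -> P' i = false.
  rewrite /P' /= leq_eqVlt => /predU1P[->|le_i lt_i]; first by rewrite eqxx.
  by rewrite P0 ?andbF.
have E : h P Q = h (predU1 k P') Q.
  by apply: h_ext => // i _; rewrite /P' /=; case: eqP => // ->.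
have P'Q i : 0 < i < n -> P' i -> Q i by move=> lt_i /andP[_]; apply: PQ.
have nP'k : ~~ P' k by rewrite /P' /= eqxx.
have := h_add P' Q k lt_k nP'k (PQ _ lt_k Pk).
rewrite -E (IH _ _ P'0 P'Q) (IH _ _ P'0) ?addr0 // => i lt_i /andP[ne_i Pi].
by rewrite /= ne_i PQ.
Qed.

Lemma nwords_add R mu la n (P Q : pred nat) i :
  noninc mu -> (forall i, mu i <= la i) -> (forall i, R <= i -> la i = 0) ->
  0 < i < n -> ~~ P i -> Q i ->
  nwords R n mu la P Q
  = nwords R n mu la (predU1 i P) Q + nwords R n mu la P (predD1 Q i).
Proof.
move=> mu_dec mu_la la_R lt_i nPi Qi; rewrite /nwords -!sum1_count.
rewrite ![\sum_(j <- _ | _) 1]big_mkcond /= -big_split /=.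
apply: eq_big_seq => w; rewrite mem_all_words => /andP[/eqP sz_w w_R].
have W := wordP mu_la la_R _ _ w_R.
have [asc|nasc] := boolP (ascent w i).
  have -> : word R mu la P (predD1 Q i) w = false.
    apply/negbTE/negP => /W[_ _ /(_ i)]; rewrite sz_w => /(_ lt_i)[_ /(_ asc)].
    by rewrite /= eqxx.
  rewrite addn0; congr (nat_of_bool _); apply/W/W => - [lat E H]; split=> // j lt_j.
    by have [H1 H2] := H j lt_j; split=> // /predU1P[->|/H1].
  by have [H1 H2] := H j lt_j; split=> // Pj; apply: H1; rewrite /= Pj orbT.
have -> : word R mu la (predU1 i P) Q w = false.
  apply/negbTE/negP => /W[_ _ /(_ i)]; rewrite sz_w => /(_ lt_i)[+ _].
  by rewrite /= eqxx (negbTE nasc) => /(_ isT).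
rewrite add0n; congr (nat_of_bool _); apply/W/W => - [lat E H]; split=> // j lt_j.
  have [H1 H2] := H j lt_j; split=> // asc; rewrite /= H2 // andbT.
  by apply: contraNneq nasc => <-.
by have [H1 H2] := H j lt_j; split=> // /H2/andP[].
Qed.

Lemma syt_add A n (P Q : pred nat) i : 0 < i < n -> ~~ P i -> Q i ->
  syt A n P Q = syt A n (predU1 i P) Q + syt A n P (predD1 Q i).
Proof. by apply: nwords_add => // j; apply: out_nrows. Qed.

Lemma eq_syt A n (P P' Q Q' : pred nat) : (forall i, 0 < i < n -> P i = P' i) ->
  (forall i, 0 < i < n -> Q i = Q' i) -> syt A n P Q = syt A n P' Q'.
Proof. by move=> EP EQ; apply: eq_nwords => // i; apply: out_nrows. Qed.

Lemma nboxesE A : nboxes A = \sum_(i < nrows A) (out A i - inn A i).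
Proof.
rewrite /nboxes -sum1_card.
rewrite (partition_big (fun x : box A => (val x).1) predT) //=.
apply: eq_bigr => i _; rewrite -card_row // sum1_card; apply: eq_card => x.
have /andP[_ lt_x] := box_bounds x; rewrite [RHS]inE unfold_in /=.
apply/eqnP/andP => [E | [/eqP E _]]; last exact: E.
by have <- : box_row x = i by apply: E.
Qed.

Lemma syt_size A n P Q : 0 < syt A n P Q -> n = nboxes A.
Proof.
have out0 := @out_nrows A; move=> /(words_ex (@inn_out A) out0)[w [<- isw]].
have [_ E _] := isw; rewrite (size_count_mem (is_word_letters out0 isw)) nboxesE.
by apply: eq_bigr => i _; rewrite -E /sh addKn.
Qed.

Lemma syt_size0 A n P Q : n != nboxes A -> syt A n P Q = 0.
Proof. by move=> ne; apply/eqP; rewrite eqn0Ngt; apply: contra ne => /syt_size->. Qed.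

Lemma psumP a i : reflect (exists2 j, j <= size a & sumn (take j a) = i) (psum a i).
Proof.
apply: (iffP idP) => [|[j le_j <-]].
  elim: a i => [|x a IH] i /=; first by rewrite orbF => /eqP->; exists 0.
  case/orP => [/eqP->|/andP[le_x /IH[j le_j E]]]; first by exists 0.
  by exists j.+1; rewrite //= E subnKC.
elim: a j le_j => [|x a IH] [|j] //= le_j.
by rewrite leq_addr addKn IH ?orbT.
Qed.

Lemma mem_set_of_comp n a (i : 'I_n) : is_comp a -> sumn a = n -> 0 < i ->
  (i \in set_of_comp n a) = psum a i.
Proof.
move=> a_pos sum_a i0; rewrite inE; apply/mapP/psumP => [[j + ->]|[j le_j E]].
  by rewrite mem_iota => lt_j; exists j => //; lia.
exists j => //; rewrite mem_iota; move: le_j; rewrite leq_eqVlt => /predU1P[Ej|lt_j].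
  by have := ltn_ord i; rewrite -E Ej take_size sum_a ltnn.
case: j E lt_j => [|j] E lt_j; last by lia.
by rewrite -E take0 in i0.
Qed.

Lemma exponents_comp m : is_comp (exponents m).
Proof.
apply/mapP => - [i]; rewrite mem_sort => i_m /esym/eqP.
by apply/negP; rewrite -mem_finsupp.
Qed.

(** Among the monomial functions in the sum, only the one indexed by the exponent sequence of [m]
    has a nonzero coefficient at [m]. *)
Lemma fundamentalE n (D : {set 'I_n}) m : D \subset Defs.interval n ->
  fundamental_qsym (comp_of_set D) m =
    ((sumn (exponents m) == n) && (D \subset set_of_comp n (exponents m)))%:R%R.
Proof.
move=> sD; have [_ sum_D ED] := comp_of_setP sD.
rewrite /fundamental_qsym sum_D ED; set e := exponents m.
have e_pos : is_comp e by apply: exponents_comp.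
have [sum_e|ne_e] := eqVneq (sumn e) n; last first.
  rewrite big1 // => E /andP[_ sE]; rewrite /monomial_qsym.
  case: eqP => // Ee; case/eqP: ne_e; rewrite /e Ee.
  by case: (comp_of_setP sE).
have [sS ES] := set_of_compP e_pos sum_e.
rewrite (big_mkcond _) (bigD1 (set_of_comp n e)) //= sS andbT big1 ?addr0.
  by rewrite /monomial_qsym ES eqxx; case: ifP.
move=> E ne_E; case: ifP => // /andP[_ sE]; rewrite /monomial_qsym.
case: eqP => // Ee; case/eqP: ne_E; rewrite /e Ee.
by case: (comp_of_setP sE) => _ _ ->.
Qed.

Lemma descent_set_interval A (T : filling A) : is_SYT T ->
  descent_set T \subset Defs.interval (nboxes A).
Proof.
by move=> sT; apply/subsetP => i; rewrite mem_descent_set // inE => /andP[].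
Qed.

(** By [fundamentalE] a tableau contributes to [m] when its descents are partial sums of the
    exponents, which is the ascent condition in [kostka]. *)
Lemma skew_schurE A m : skew_schur A m = (kost A (exponents m))%:R%R.
Proof.
rewrite /skew_schur; set e := exponents m.
have e_pos : is_comp e by apply: exponents_comp.
rewrite (eq_bigr (fun T => ((sumn e == nboxes A) &&
     (descent_set T \subset set_of_comp (nboxes A) e))%:R%R)); last first.
  by move=> T sT; rewrite /descent_comp fundamentalE ?descent_set_interval.
have [sum_e|ne_e] := eqVneq (sumn e) (nboxes A); last first.
  by rewrite big1 // /kost /kostka -/(syt _ _ _ _) syt_size0.
rewrite /kost /kostka -/(syt A _ _ _) sum_e -card_sytab -sum1_card natr_sum.
rewrite [LHS]big_mkcond [RHS]big_mkcond /=; apply: eq_bigr => T _.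
rewrite inE; case: (boolP (is_SYT T)) => sT //=.
have -> : (descent_set T \subset set_of_comp (nboxes A) e) =
  [forall i : 'I_(nboxes A), (0 < i) ==> (ascent (row_word T) i ==> psum e i)].
  apply/subsetP/forallP => [H i|H i].
    apply/implyP => i0; apply/implyP => asc; rewrite -(@mem_set_of_comp (nboxes A)) //.
    by apply: H; rewrite mem_descent_set ?i0.
  rewrite mem_descent_set // => /andP[i0 asc]; rewrite mem_set_of_comp //.
  by have := H i; rewrite i0 asc.
by case: [forall i, _].
Qed.

(** * Transposition and rectangles *)

Lemma eq_from_ltn x y : (forall i, (i < x) = (i < y)) -> x = y.
Proof. by move=> E; apply/eqP; rewrite eqn_leq leqNgt E ltnn leqNgt -E ltnn. Qed.

Lemma size_part (l : intpart) i : (i < size l) = (0 < nth 0 l i).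
Proof.
case: ltnP => [lt_i|/(nth_default 0)->//]; case: l lt_i => s /= /andP[_ s0] lt_i.
by apply/esym; rewrite lt0n; apply: contra s0 => /eqP<-; rewrite mem_nth.
Qed.

Lemma conj_dec (l : seq nat) : noninc (fun j => count (fun x => j < x) l).
Proof. by move=> j; apply: sub_count => x /ltnW. Qed.

Definition conj_part (l : intpart) : intpart := part_of (head 0 l) (conj_dec l).

Lemma nth_conj_part l j : nth 0 (conj_part l) j = count (fun x => j < x) l.
Proof.
apply: nth_part_of => i le_i; apply/eqP; rewrite -leqn0 leqNgt -has_count.
apply/hasPn => x /(nthP 0)[k _ <-]; rewrite -leqNgt; apply: leq_trans le_i.
by rewrite -nth0 (noninc_le (nth_part_dec l)).
Qed.

(** Both sides say that the box in row [i] and column [j] lies in the diagram of [l]; the facts on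
    conjugates and transposes are read off from this. *)
Lemma conj_part_lt l i j : (i < nth 0 (conj_part l) j) = (j < nth 0 l i).
Proof.
rewrite nth_conj_part; have := nth_part_dec l.
elim: (val l : seq nat) i => [|x s IH] i s_dec /=; first by rewrite nth_nil ltn0.
have {}IH i' := IH i' (fun k => s_dec k.+1).
have [lt_x|le_x] := ltnP j x; first by case: i => [|i] /=; rewrite ?lt_x // add1n ltnS IH.
have -> : count (fun y => j < y) s = 0.
  apply/eqP; rewrite -leqn0 leqNgt -has_count; apply/hasPn => y /(nthP 0)[k _ <-].
  by rewrite -leqNgt; apply: leq_trans le_x; apply: (noninc_le s_dec (leq0n k.+1)).
apply/esym/negbTE; rewrite -leqNgt; apply: leq_trans le_x.
exact: (noninc_le s_dec (leq0n i)).
Qed.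

Lemma conj_partK : involutive conj_part.
Proof.
by move=> l; apply: part_inj => i; apply: eq_from_ltn => j; rewrite !conj_part_lt.
Qed.

Lemma size_conj_part l : size (conj_part l) = head 0 l.
Proof. by apply: eq_from_ltn => i; rewrite size_part conj_part_lt nth0. Qed.

Lemma head_conj_part l : head 0 (conj_part l) = size l.
Proof. by rewrite -size_conj_part conj_partK. Qed.

Lemma tr_subproof A i : nth 0 (conj_part (inner A)) i <= nth 0 (conj_part (outer A)) i.
Proof.
rewrite leqNgt conj_part_lt -leqNgt.
by apply: leq_trans (inn_out A _) _; rewrite leqNgt -conj_part_lt ltnn.
Qed.

Definition tr A := SkewShape (@tr_subproof A).

Lemma in_tr A i j : in_shape (tr A) i j = in_shape A j i.
Proof. by rewrite /in_shape /= leqNgt !conj_part_lt -leqNgt. Qed.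

Lemma nrows_tr A : nrows (tr A) = ncols A. Proof. exact: size_conj_part. Qed.
Lemma ncols_tr A : ncols (tr A) = nrows A. Proof. exact: head_conj_part. Qed.

Lemma syt_straight_tr l n P Q :
  syt (tr (straight l)) n P Q = syt (straight (conj_part l)) n P Q.
Proof.
by apply: eq_nwords => // i; apply: out_nrows.
Qed.

Lemma syt_tr A n P : syt (tr A) n P P = syt A n (predC P) (predC P).
Proof.
have AB i j : in_shape A i j = in_shape (tr A) j i by rewrite in_tr.
have En := nboxes_tr AB.
have [->|ne_n] := eqVneq n (nboxes A); last first.
  by rewrite !syt_size0 // -En.
have K B m : syt B m (predC (predC P)) (predC (predC P)) = syt B m P P.
  by apply: eq_syt => i _ /=; rewrite negbK.
have BA i j : in_shape (tr A) i j = in_shape A j i by rewrite in_tr.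
apply/eqP; rewrite eqn_leq {1 2}En (syt_tr_le BA).
by rewrite -(K (tr A)) syt_tr_le.
Qed.

(** The descent set whose first element is [c] and whose remaining elements form [P] shifted by [c]:
    a run of length [c] followed by the pattern [P]. *)
Definition ext_pred c (P : pred nat) : pred nat :=
  fun i => (c <= i) && ((i == c) || P (i - c)).

Lemma ext_pred_lo c P i : 0 < i < c -> ext_pred c P i = false.
Proof. by rewrite /ext_pred => /andP[_ lt_i]; rewrite leqNgt lt_i. Qed.

Lemma syt_peel_ext A n P :
  syt A (ncol A + n) (ext_pred (ncol A) P) (ext_pred (ncol A) P)
  = syt (peel A) n P P.
Proof.
apply: syt_peel => [i lt_i|_|i i0]; first by rewrite !ext_pred_lo.
  by rewrite /ext_pred leqnn eqxx.
by rewrite /ext_pred leq_addr addKn -[X in _ == X]addn0 eqn_add2l (gtn_eqF i0).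
Qed.

Lemma kost_peel A a : kost A (ncol A :: a) = kost (peel A) a.
Proof.
apply: (@syt_peel A _ pred0 _ pred0) => [i /andP[i0 lt_i]|c0|i i0].
- by rewrite /= (gtn_eqF i0) leqNgt lt_i.
- by rewrite /= leqnn subnn psum0 orbT.
by rewrite /= leq_addr addKn addn_eq0 (gtn_eqF i0) andbF.
Qed.

Lemma kost_ncol A m a : ncol A < m -> kost A (m :: a) = 0.
Proof.
move=> lt_m; apply: (@syt_ncol A _ _ _ m) => //=; first exact: leq_addr.
by move=> i /andP[i0 lt_i]; rewrite (gtn_eqF i0) leqNgt lt_i.
Qed.

Lemma lattice_exists R mu la : noninc mu -> noninc la ->
  (forall i, mu i <= la i) -> (forall i, R <= i -> la i = 0) ->
  exists2 w, lattice mu w & sh mu w =1 la.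
Proof.
move=> mu_dec la_dec mu_la la_R.
move: {2}(\sum_(i < R) (la i - mu i)) (leqnn (\sum_(i < R) (la i - mu i))) => n.
elim: n mu mu_dec mu_la => [|n IH] mu mu_dec mu_la le_n.
  exists [::]; first by move=> k i; rewrite /sh !addn0; apply: mu_dec.
  move=> i; rewrite /sh addn0; apply/eqP; rewrite eqn_leq mu_la /=.
  have [lt_i|/la_R->//] := ltnP i R.
  by move: le_n; rewrite leqn0 sum_nat_eq0 => /forallP/(_ (Ordinal lt_i)).
have [full|] := boolP [forall i : 'I_R, la i <= mu i].
  apply: (IH mu) => //; rewrite big1 // => i _; apply/eqP.
  by rewrite subn_eq0; apply: (forallP full).
rewrite negb_forall => /existsP[i0]; rewrite -ltnNge => lt_i0.
have ex_i : exists i, mu i < la i by exists i0.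
(* A box is added in the topmost incomplete row [i]: the row above is complete, so it is at least as
   long as [la i] and the shape stays a partition. *)
have [i lt_i min_i] := ex_minnP ex_i.
have lt_R : i < R by rewrite ltnNge; apply/negP => /la_R la0; rewrite la0 in lt_i.
have sh1 j : sh mu [:: i] j = mu j + (i == j) by rewrite /sh /= addn0.
have mu'_dec : noninc (sh mu [:: i]).
  move=> j; rewrite !sh1; case: (i =P j.+1) => [Ei|_]; last first.
    by rewrite addn0 (leq_trans (mu_dec j)) ?leq_addr.
  rewrite addn1 (gtn_eqF (_ : j < i)) ?addn0 ?Ei // -Ei; apply: leq_trans lt_i _.
  rewrite Ei (leq_trans (la_dec j)) // leqNgt; apply/negP => /min_i.
  by rewrite Ei ltnn.
have [|||w lat Ew] := IH (sh mu [:: i]) => //.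
- by move=> j; rewrite sh1; case: eqP => [<-|_]; rewrite ?addn1 ?addn0.
- rewrite -ltnS; apply: leq_trans le_n; rewrite (bigD1 (Ordinal lt_R)) //=.
  rewrite [X in _ < X](bigD1 (Ordinal lt_R)) //= -addSn leq_add //.
    by rewrite sh1 eqxx addn1 subnSK.
  by apply: leq_sum => j _; apply: leq_sub2l; apply: sh_le.
exists (i :: w); last by move=> j; rewrite -cat1s sh_cat.
rewrite -cat1s; apply/lattice_cat; split=> //.
by move=> [|[|k]] j; rewrite /= ?mu'_dec // /sh /= !addn0.
Qed.

Lemma syt_exists A : exists P, 0 < syt A (nboxes A) P P.
Proof.
have out0 := @out_nrows A.
have [w lat Ew] := lattice_exists (@inn_dec A) (@out_dec A) (@inn_out A) out0.
have isw : is_word (inn A) (out A) (ascent w) (ascent w) w by split.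
have gt0 : 0 < syt A (size w) (ascent w) (ascent w).
  by apply/(words_ex (@inn_out A) out0); exists w.
by exists (ascent w); rewrite -(syt_size gt0).
Qed.

Definition rectb (D : rel nat) k l i j :=
  all (fun p => all (fun q => D (i + p) (j + q)) (iota 0 l)) (iota 0 k).

Lemma rectsE k l A :
  rects k l A = \sum_(i < nrows A) \sum_(j < ncols A) rectb (in_shape A) k l i j.
Proof.
rewrite /rects -sum1_card big_mkcond pair_big /=; apply: eq_bigr => x _.
rewrite inE; suff -> : [forall p : 'I_k, forall q : 'I_l, in_shape A (x.1 + p) (x.2 + q)]
  = rectb (in_shape A) k l x.1 x.2 by case: rectb.
apply/forallP/allP => [H p | H p].
  rewrite mem_iota => /= lt_p; apply/allP => q; rewrite mem_iota => /= lt_q.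
  by have /forallP/(_ (Ordinal lt_q)) := H (Ordinal lt_p).
apply/forallP => q; have /H/allP/(_ (val q)) : val p \in iota 0 k by rewrite mem_iota /=.
by apply; rewrite mem_iota /=.
Qed.

Lemma rects_tr k l A : rects k l (tr A) = rects l k A.
Proof.
rewrite !rectsE nrows_tr ncols_tr exchange_big /=.
apply: eq_bigr => i _; apply: eq_bigr => j _; congr nat_of_bool.
apply/allP/allP => H p p_in; apply/allP => q q_in.
  by have /allP/(_ p p_in) := H q q_in; rewrite in_tr.
by have /allP/(_ p p_in) := H q q_in; rewrite in_tr.
Qed.

(** Rectangles in [A] with top row [i] correspond to rectangles in [peel A], one row shorter, with
    top row [i.+1]. The sums match because row [0] of [peel A] is empty and no rectangle of height
    at least two starts in the last row of [A]. *)
Lemma rects_peel k l A : 0 < l -> rects k.+2 l A = rects k.+1 l (peel A).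
Proof.
case: l => // l _; rewrite !rectsE.
change (ncols (peel A)) with (ncols A); change (nrows (peel A)) with (nrows A).
pose g B k' i := \sum_(j < ncols A) rectb (in_shape B) k' l.+1 i j.
rewrite -!/(g _ _ _).
have g0 : g (peel A) k.+1 0 = 0.
  by rewrite /g big1 // => j _; rewrite /rectb /= add0n in_peel0.
have gS i : g (peel A) k.+1 i.+1 = g A k.+2 i.
  apply: eq_bigr => j _; congr nat_of_bool; apply/allP/allP => H p p_in; apply/allP => q q_in.
    case: p p_in => [|p] p_in.
      have /allP/(_ q q_in) := H 0 isT.
      by rewrite addSn in_peelS addn0 => /andP[].
    have /H/allP/(_ q q_in) : p \in iota 0 k.+1 by move: p_in; rewrite !mem_iota.
    by rewrite addSn in_peelS addnS => /andP[].
  rewrite addSn in_peelS -addnS; move: p_in; rewrite mem_iota => /= lt_p.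
  have /H/allP/(_ q q_in) -> : p \in iota 0 k.+2 by rewrite mem_iota /= add0n ltnW.
  by have /H/allP/(_ q q_in) -> : p.+1 \in iota 0 k.+2 by rewrite mem_iota /=.
case ER: (nrows A) => [|R]; first by rewrite !big_ord0.
rewrite big_ord_recr [RHS]big_ord_recl /= -/(g A k.+2 R) -/(g (peel A) k.+1 0) g0 add0n.
have -> : g A k.+2 R = 0.
  rewrite /g big1 // => j _; rewrite /rectb /= addn1 /in_shape.
  by rewrite [nth 0 (outer A) R.+1]nth_default -?/(nrows A) ?ER // ltn0 !andbF.
by rewrite addn0; apply: eq_bigr => i _; apply/esym/gS.
Qed.

Lemma sum_itv a b c : b <= c -> \sum_(j < c) (a <= j < b) = b - a.
Proof.
move=> le_bc; rewrite -(@big_mkord _ 0 addn c predT (fun j => (a <= j < b : nat))).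
rewrite (@big_cat_nat _ _ _ b) //= [X in _ + X]big_nat_cond [X in _ + X]big1; last first.
  by move=> j; rewrite andbT => /andP[le_j _]; rewrite [j < b]ltnNge le_j andbF.
rewrite addn0; elim: b {le_bc} => [|b IH]; first by rewrite big_geq.
rewrite big_nat_recr //= ltnSn andbT.
have -> : \sum_(0 <= j < b) (a <= j < b.+1) = \sum_(0 <= j < b) (a <= j < b).
  by apply: eq_big_nat => j /andP[_ lt_j]; rewrite ltnS lt_j (ltnW lt_j).
by rewrite IH; case: (leqP a b); lia.
Qed.

Lemma out_ncols A i : out A i <= ncols A.
Proof. by rewrite /ncols -nth0; apply: noninc_le (out_dec A) _. Qed.

Lemma rects11 A : rects 1 1 A = nboxes A.
Proof.
rewrite nboxesE rectsE; apply: eq_bigr => i _; rewrite -(sum_itv _ (out_ncols A i)).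
by apply: eq_bigr => j _; rewrite /rectb /= !addn0 !andbT.
Qed.

Lemma rects_rel (rel : skew_shape -> skew_shape -> Prop) :
  (forall A B, rel A B -> [/\ nboxes A = nboxes B, rel (peel A) (peel B) & rel (tr A) (tr B)]) ->
  forall A B, rel A B -> forall k l, 0 < k -> 0 < l -> rects k l A = rects k l B.
Proof.
move=> H A B AB [|k] l // _; elim: k l A B AB => [|k IH] l A B AB l0; last first.
  by rewrite !rects_peel //; apply: IH => //; case: (H A B AB).
(* At height one the width is reduced instead: transposing turns it into a height, to be lowered
   again by peeling. *)
case: l l0 => // l _; rewrite -!(rects_tr l.+1 1).
have [_ _ {}AB] := H A B AB; move: (tr A) (tr B) AB => {}A {}B.
elim: l A B => [|l IH] A B AB; first by rewrite !rects11; case: (H A B AB).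
by rewrite !rects_peel //; apply: IH; case: (H A B AB).
Qed.

(** * Rectangles and row overlaps *)

(** Over consecutive rows the inner bound is strongest in the top row and the outer bound in the
    bottom row. *)
Lemma in_rows A k i j :
  all (fun p => in_shape A p j) (iota i k.+1) = (inn A i <= j < out A (i + k)).
Proof.
apply/allP/idP => [H | /andP[le_j lt_j] p].
  have /andP[-> _] : in_shape A i j by apply: H; rewrite mem_iota leqnn; lia.
  by have /andP[_ ->] : in_shape A (i + k) j by apply: H; rewrite mem_iota; lia.
rewrite mem_iota addnS ltnS => /andP[le_i le_p]; rewrite /in_shape -/(inn A p) -/(out A p).
by rewrite (leq_trans (noninc_le (@inn_dec A) le_i)) ?(leq_trans lt_j (noninc_le (@out_dec A) le_p)).
Qed.

Lemma overlapE A k i : overlap (in_shape A) (ncols A) k.+1 i = out A (i + k) - inn A i.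
Proof.
rewrite /overlap (eq_count (in_rows A k i)) -(sum_itv _ (out_ncols A (i + k))).
by rewrite -sum1_count big_mkcond /= -{1}[ncols A]subn0 big_mkord.
Qed.

(** The columns common to [k.+1] consecutive rows form an interval; one of length [x] has [x - l]
    windows of length [l.+1], where truncated subtraction covers the case that none fits. *)
Lemma rects_overlap A k l :
  rects k.+1 l.+1 A = \sum_(i < nrows A) (out A (i + k) - inn A i - l).
Proof.
rewrite rectsE; apply: eq_bigr => i _; rewrite subnAC.
rewrite -(@sum_itv _ _ (ncols A)); last exact: leq_trans (leq_subr _ _) (out_ncols _ _).
apply: eq_bigr => j _; congr nat_of_bool.
transitivity (all (fun q => inn A i <= j + q < out A (i + k)) (iota 0 l.+1)).
  apply/allP/allP => [H q q_in | H p p_in].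
    rewrite -in_rows; apply/allP => p; rewrite -[i : nat]addn0 iotaDl => /mapP[p' p'_in ->].
    by have /allP/(_ q q_in) := H p' p'_in.
  apply/allP => q /H; rewrite -in_rows => /allP/(_ (i + p)); apply.
  by rewrite -{2}[i : nat]addn0 iotaDl map_f.
apply/allP/idP => [H | /andP[le_j lt_j] q].
  have : inn A i <= j + 0 < out A (i + k) by apply: H.
  have : inn A i <= j + l < out A (i + k) by apply: H; rewrite mem_iota /=.
  by lia.
by rewrite mem_iota => /= lt_q; lia.
Qed.

Lemma rects_rows A k l : rects k.+1 l.+1 A = \sum_(x <- rows k.+1 A) (x - l).
Proof.
rewrite rects_overlap /rows /overlap_part.
rewrite (perm_big _ (permEl (perm_sort _ _))) /= big_filter big_map.
rewrite (eq_bigr (fun i => out A (i + k) - inn A i - l)); last first.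
  by move=> i _; rewrite overlapE.
pose F i := out A (i + k) - inn A i - l.
have F0 i : (if overlap (in_shape A) (ncols A) k.+1 i != 0 then F i else 0) = F i.
  by rewrite overlapE /F; case: eqP => // ->.
rewrite -(@big_mkord _ 0 addn (nrows A) predT F) [RHS]big_mkcond /= subSS.
rewrite [RHS](eq_bigr F) => [|i _]; last exact: F0.
(* The overlaps stop at [nrows A - k]; later rows contribute zero, as the row [k] steps further down
   lies outside the diagram. *)
rewrite /index_iota subn0 -{1}(subnKC (leq_subr k (nrows A))) iotaD big_cat /=.
rewrite [X in _ + X]big1_seq ?addn0 //.
move=> i /andP[_]; rewrite mem_iota => /andP[le_i _]; rewrite /F out_nrows ?sub0n //; lia.
Qed.

Lemma rows_part k A : is_part (rows k A).
Proof.
rewrite /is_part /rows /overlap_part mem_sort mem_filter eqxx andbT.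
by apply: sort_sorted => x y; apply: leq_total.
Qed.

(** The sums for [l] and [l.+1] differ by the number of parts greater than [l], which is a part of
    the conjugate partition. *)
Lemma part_eq_sums (s t : intpart) :
  (forall l, \sum_(x <- s) (x - l) = \sum_(x <- t) (x - l)) -> s = t.
Proof.
have cnt (u : seq nat) l : \sum_(x <- u) (x - l) = count (fun x => l < x) u + \sum_(x <- u) (x - l.+1).
  rewrite -sum1_count [X in X + _]big_mkcond -big_split; apply: eq_bigr => x _ /=.
  by case: ltnP; lia.
move=> E; rewrite -[s]conj_partK -[t]conj_partK; congr conj_part.
apply: part_inj => l; rewrite !nth_conj_part; apply/eqP.
by rewrite -(eqn_add2r (\sum_(x <- s) (x - l.+1))) -cnt E cnt -E.
Qed.

Lemma rows_rects A B :
  (forall k, 1 <= k -> rows k A = rows k B) <->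
  (forall k l, 1 <= k -> 1 <= l -> rects k l A = rects k l B).
Proof.
split=> [H [|k] [|l] // _ _ | H [|k] // _]; first by rewrite !rects_rows H.
have := @part_eq_sums (IntPart (rows_part k.+1 A)) (IntPart (rows_part k.+1 B)).
by move=> /(_ (fun l => _))/(congr1 val) /= ->// l; rewrite -!rects_rows H.
Qed.

Lemma cols_tr l A : cols l A = rows l (tr A).
Proof.
rewrite /cols /rows nrows_tr ncols_tr /overlap_part.
congr (sort _ (filter _ _)); apply: eq_map => i; apply: eq_count => j.
by apply: eq_all => p; rewrite in_tr.
Qed.

Lemma cols_rects A B :
  (forall l, 1 <= l -> cols l A = cols l B) <->
  (forall k l, 1 <= k -> 1 <= l -> rects k l A = rects k l B).
Proof.
have trP := rows_rects (tr A) (tr B); split=> H.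
  by move=> k l k1 l1; rewrite -!(rects_tr l k) (iffLR trP) // => m m1; rewrite -!cols_tr H.
by move=> l l1; rewrite !cols_tr (iffRL trP) // => k m k1 m1; rewrite !rects_tr H.
Qed.

(** * Schur expansions *)

Definition symmetric (g : seq nat -> int) :=
  forall a b x y, g (a ++ x :: y :: b) = g (a ++ y :: x :: b).

Lemma symmetric_front g a x b : symmetric g -> g (a ++ x :: b) = g (x :: a ++ b).
Proof.
move=> g_sym; elim/last_ind: a b => [|a y IH] b //=.
by rewrite -!cats1 -!catA /= g_sym IH.
Qed.

Lemma kost_swap A a b x y : kost A (a ++ x :: y :: b) = kost A (a ++ y :: x :: b).
Proof. by apply: kostka_swap => // i; apply: out_nrows. Qed.

Lemma kost_size0 A a : sumn a != nboxes A -> kost A a = 0.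
Proof. exact: syt_size0. Qed.

Lemma nboxes_straight (l : intpart) : nboxes (straight l) = sumn l.
Proof.
rewrite nboxesE sumnE (big_nth 0) big_mkord; apply: eq_bigr => i _.
by rewrite /inn /= nth_nil subn0.
Qed.

Lemma kost_straight_behead (l : intpart) a :
  kost (straight l) (head 0 l :: a) = kost (straight (behead_part l)) a.
Proof. by rewrite -ncol_straight kost_peel; apply: syt_peel_straight. Qed.

(** The default [empty_part] is the right value for [x = 0] and empty [l]: it makes
    [cons_behead_part] true for the empty partition as well. *)
Definition cons_part x (l : intpart) : intpart := insubd empty_part (x :: l).

Lemma val_cons_part x (l : intpart) : 0 < x -> head 0 l <= x -> cons_part x l = x :: l :> seq nat.
Proof.
case: l => l Pl /= x0 le_x; have /andP[l_dec l0] := Pl; rewrite /cons_part insubdK //.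
rewrite unfold_in /is_part inE negb_or eq_sym -lt0n x0 l0 /= andbT.
by case: l l_dec le_x {l0 Pl} => //= y s -> ->.
Qed.

Lemma behead_cons_part x (l : intpart) : 0 < x -> head 0 l <= x -> behead_part (cons_part x l) = l.
Proof. by move=> x0 le_x; apply: val_inj; rewrite /= val_cons_part. Qed.

Lemma cons_behead_part (l : intpart) : cons_part (head 0 l) (behead_part l) = l.
Proof.
apply: val_inj; case: l => [[|x s] Ps] /=; first by rewrite /cons_part /insubd insubF.
by rewrite /cons_part insubdK.
Qed.

Definition schur_sum (L : seq (intpart * int)) (a : seq nat) : int :=
  (\sum_(p <- L) p.2 * (kost (straight p.1) a)%:R)%R.

(* Induction on the largest part [m] of a composition where [g] is nonzero: the
   function [a |-> g (m :: a)] is a combination of Schur functions, and adding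
   a first row of length [m] to each of them gives the part of [g] supported
   on compositions with a part [m]. *)
Lemma schur_expansion (n m : nat) g : symmetric g ->
  (forall a, is_comp a -> sumn a != n -> g a = 0%R) ->
  (forall a, is_comp a -> has (fun x => m < x) a -> g a = 0%R) ->
  exists L : seq (intpart * int), (forall p, p \in L -> head 0 p.1 <= m /\ sumn p.1 = n) /\
    (forall a, is_comp a -> g a = schur_sum L a).
Proof.
have [N] := ubnP n; elim: N n m g => // N IHn n m g le_n.
elim: m g => [|m IHm] g g_sym g_n g_m.
  (* With no positive part allowed, [g] lives on the empty composition alone. *)
  have g_nil a : is_comp a -> a != [::] -> g a = 0%R.
    move=> a_pos a_n0; apply: g_m => //; rewrite -[has _ _]negbK -all_predC.
    apply: contra a_pos; case: a a_n0 => //= x a _ /andP[+ _].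
    by rewrite -eqn0Ngt inE => /eqP->.
  have [n0|n_n0] := eqVneq n 0; last first.
    exists [::]; split=> // a a_pos; rewrite /schur_sum big_nil.
    by have [-> |/g_nil->//] := eqVneq a [::]; apply: g_n => //=; rewrite eq_sym.
  exists [:: (empty_part, g [::])]; split=> [p|a a_pos].
    by rewrite inE => /eqP-> /=; rewrite n0.
  rewrite /schur_sum big_seq1 /=.
  have [->|a_n0] := eqVneq a [::].
    suff -> : kost (straight empty_part) [::] = 1 by rewrite mulr1.
    have [P] := syt_exists (straight empty_part); rewrite nboxes_straight /= => gt0.
    rewrite /kost /kostka /nwords /all_words.
    have -> : enum {: 0.-tuple 'I_(nrows (straight empty_part))} = [:: [tuple]].
      by apply: (@perm_small_eq _ _ [:: _]) => //; apply: uniq_perm;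
        rewrite ?enum_uniq // => t; rewrite mem_enum !inE tuple0 eqxx.
    by [].
  rewrite g_nil // kost_size0 ?mulr0 // nboxes_straight /=.
  by case: a a_n0 a_pos => // -[|x] a.
have mem_lt (x : nat) a : x \in a -> x <= sumn a.
  by elim: a => //= y a IH; rewrite inE => /predU1P[->|/IH]; lia.
(* If [n <= m], no composition of [n] has a part greater than [m], so the bound [m] applies
   already. *)
have [lt_m|le_m] := ltnP n m.+1.
  have [//|a a_pos a_m|L [HL EL]] := IHm g g_sym.
    have /hasP[x x_a lt_x] := a_m; apply: g_n => //.
    by have := mem_lt _ _ x_a; lia.
  by exists L; split=> // p /HL[le_p ->]; rewrite leqW.
pose g1 a := g (m.+1 :: a).
have comp_cons a x : is_comp a -> is_comp (x.+1 :: a) by rewrite /is_comp inE.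
have [||||L1 [HL1 EL1]] := IHn (n - m.+1) m.+1 g1.
- by lia.
- by move=> a b x y; apply: (g_sym (m.+1 :: a)).
- by move=> a a_pos ne_a; apply: g_n; [exact: comp_cons | rewrite /=; lia].
- by move=> a a_pos a_m; apply: g_m; [exact: comp_cons | rewrite /= a_m orbT].
pose L1' := [seq (cons_part m.+1 p.1, p.2) | p <- L1].
have HL1' p : p \in L1' -> head 0 p.1 = m.+1 /\ sumn p.1 = n.
  move=> /mapP[q /HL1[le_q sum_q] ->] /=; rewrite val_cons_part //= sum_q.
  by rewrite subnKC.
pose g2 a := (g a - schur_sum L1' a)%R.
have sum_sym : symmetric (schur_sum L1').
  by move=> a b x y; apply: eq_bigr => p _; rewrite kost_swap.
have g2_sym : symmetric g2 by move=> a b x y; rewrite /g2 g_sym sum_sym.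
have [||L2 [HL2 EL2]] := IHm g2 g2_sym.
- move=> a a_pos ne_a; rewrite /g2 g_n // sub0r /schur_sum big_seq big1 ?oppr0 //.
  by move=> p /HL1'[_ sum_p]; rewrite kost_size0 ?mulr0 // nboxes_straight sum_p.
(* By symmetry the large part is moved to the front. If it exceeds [m.+1], then [g] vanishes, and so
   do the shapes of [L1'], whose first rows have length [m.+1]. If it equals [m.+1], removing first
   rows reduces the claim to the choice of [L1]. *)
- move=> a a_pos /hasP[x x_a lt_x].
  case/splitPr: x_a a_pos => a1 a2 a_pos; rewrite symmetric_front //.
  have a'_pos : is_comp (a1 ++ a2).
    by move: a_pos; rewrite /is_comp !mem_cat inE !negb_or => /and3P[-> _ ->].
  have xa_pos : is_comp (x :: a1 ++ a2) by case: x lt_x {a_pos} => // x _; apply: comp_cons.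
  move: lt_x; rewrite leq_eqVlt => /predU1P[Ex|lt_x]; last first.
    rewrite /g2 g_m //= ?lt_x // sub0r /schur_sum big_seq big1 ?oppr0 //.
    by move=> p /HL1'[Ep _]; rewrite kost_ncol ?mulr0 // ncol_straight Ep.
  rewrite -Ex /g2 -/(g1 _) EL1 // /schur_sum big_map; apply/eqP; rewrite subr_eq0; apply/eqP.
  apply: eq_big_seq => p /HL1[le_p _] /=; congr (_ * _%:R)%R.
  have := kost_straight_behead (cons_part m.+1 p.1) (a1 ++ a2).
  by rewrite val_cons_part //= behead_cons_part.
exists (L1' ++ L2); split=> [p|a a_pos].
  by rewrite mem_cat => /orP[/HL1'[-> ->]|/HL2[le_p ->]]; rewrite ?leqnn // leqW.
by rewrite /schur_sum big_cat /= -/(schur_sum _ _) -/(schur_sum L2 _) -EL2 // addrC subrK.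
Qed.

Lemma finsupp_sum (I : choiceType) (c : {fsfun I -> int with 0%R}) (s : seq I) (F : I -> int) :
  uniq s -> {subset finsupp c <= s} ->
  (\sum_(i <- finsupp c) c i * F i = \sum_(i <- s) c i * F i)%R.
Proof.
move=> Us sub; rewrite [RHS](bigID (fun i => i \in finsupp c)) /=.
rewrite [X in _ = (_ + X)%R]big1 => [|i ni]; last by rewrite fsfun_dflt ?mul0r.
rewrite addr0 -[RHS]big_filter; apply: perm_big; apply: uniq_perm.
- exact: fset_uniq.
- exact: filter_uniq.
by move=> i; rewrite mem_filter; case: (boolP (i \in _)) => //= /sub ->.
Qed.

(** An index may occur several times in [L]; [F] collects its coefficients. *)
Lemma list_expansion (I : choiceType) (b : I -> series) f (L : seq (I * int)) :
  (forall m, f m = (\sum_(p <- L) p.2 * b p.1 m)%R) -> exists c, expansion b f c.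
Proof.
move=> Ef; pose s := [fset i | i in unzip1 L]%fset.
pose F i := (\sum_(p <- L | p.1 == i) p.2)%R.
pose c : {fsfun I -> int with 0%R} := [fsfun i in s => F i].
have s_in p : p \in L -> p.1 \in s.
  by move=> p_L; rewrite !inE /=; apply/mapP; exists p.
exists c => m; rewrite Ef (@finsupp_sum _ c s (fun i => b i m)); last 2 first.
- exact: fset_uniq.
- by move=> i; apply: contraTT => ni; rewrite mem_finsupp fsfunE (negbTE ni) eqxx.
transitivity (\sum_(i <- s) \sum_(p <- L) (if p.1 == i then p.2 * b p.1 m else 0))%R.
  rewrite exchange_big /=; apply: eq_big_seq => p /s_in p_s.
  rewrite (bigD1_seq p.1) ?fset_uniq //= eqxx big1 ?addr0 // => i /negbTE ne_i.
  by rewrite eq_sym ne_i.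
apply: eq_big_seq => i i_s; rewrite fsfunE i_s /F mulr_suml -big_mkcond.
by apply: eq_bigr => p /eqP->.
Qed.

(** This keeps [supp_s A] from being empty for lack of an expansion. The bound on the parts is the
    number of boxes. *)
Lemma schur_expansion_exists A : exists c, expansion schur (skew_schur A) c.
Proof.
have [|||L [_ EL]] := @schur_expansion (nboxes A) (nboxes A) (fun a => (kost A a)%:R%R).
- by move=> a b x y; rewrite kost_swap.
- by move=> a _ ne_a; rewrite kost_size0.
- move=> a _ /hasP[x x_a lt_x]; rewrite kost_size0 //.
  suff : x <= sumn a by lia.
  by elim: (a) x_a => //= y s IH; rewrite inE => /predU1P[->|/IH]; lia.
apply: (@list_expansion _ _ _ L) => m; rewrite skew_schurE EL ?exponents_comp //.
by apply: eq_bigr => p _; rewrite /schur skew_schurE.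
Qed.

(** * From monomial coefficients to descent sets *)

Lemma monom_exists n (Q : pred nat) : exists m,
  sumn (exponents m) = n /\ forall i, 0 < i < n -> psum (exponents m) i = Q i.
Proof.
pose D := [set i : 'I_n | (0 < i) && Q i].
have sD : D \subset Defs.interval n by apply/subsetP => i; rewrite !inE => /andP[].
have [a_pos sum_a ED] := comp_of_setP sD; set a := comp_of_set D in a_pos sum_a ED.
pose m : monom := [fsfun i in seq_fset tt (iota 0 (size a)) => nth 0 a i].
have m_nth v : m v = nth 0 a v.
  rewrite fsfunE seq_fsetE mem_iota add0n /=.
  by case: ltnP => // le_v; rewrite nth_default.
have Em : exponents m = a.
  apply/eqP/(monomial_qsymP m a_pos); exists (iota 0 (size a)); split.
  - exact: iota_ltn_sorted.
  - exact: size_iota.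
  move=> v; rewrite m_nth; have [lt_v|le_v] := ltnP v (size a).
    rewrite (big_pred1 (Ordinal lt_v)) // => j.
    by rewrite nth_iota // add0n -val_eqE.
  rewrite nth_default // big_pred0 // => j; rewrite nth_iota // add0n.
  by apply/negbTE; rewrite neq_ltn (leq_trans (ltn_ord j)).
exists m; rewrite Em; split=> // i /andP[i0 lt_i].
by rewrite -(@mem_set_of_comp n a (Ordinal lt_i)) // ED inE i0.
Qed.

(** The bridge from series to descent sets: an additive [h] that has the monomial coefficients of
    [skew_schur A] at empty lower bound must count tableaux. It is applied to a Schur expansion, to
    an equal skew Schur function and to an expansion in fundamental functions. *)
Lemma syt_inversion n (A : skew_shape) (h : pred nat -> pred nat -> int) :
  (forall P P' Q Q', (forall i, 0 < i < n -> P i = P' i) ->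
     (forall i, 0 < i < n -> Q i = Q' i) -> h P Q = h P' Q') ->
  (forall (P Q : pred nat) i, 0 < i < n -> ~~ P i -> Q i ->
     h P Q = (h (predU1 i P) Q + h P (predD1 Q i))%R) ->
  (forall m, sumn (exponents m) = n -> h pred0 (psum (exponents m)) = skew_schur A m) ->
  forall P, h P P = (syt A n P P)%:R%R.
Proof.
move=> h_ext h_add h0 P; apply/eqP; rewrite -subr_eq0; apply/eqP.
pose h' P Q := (h P Q - (syt A n P Q)%:R)%R.
apply: (@interval_inversion n h') => // [P' P'' Q Q' EP EQ|P' Q i lt_i nPi Qi|Q]; rewrite /h'.
- by rewrite (h_ext _ _ _ _ EP EQ) (eq_syt _ EP EQ).
- by rewrite (h_add _ _ _ lt_i nPi Qi) (syt_add _ lt_i nPi Qi) natrD opprD addrACA.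
have [m [sum_m Em]] := monom_exists n Q.
rewrite -(h_ext pred0 pred0 _ _ _ Em) // -(@eq_syt A n pred0 pred0 _ _ _ Em) //.
by rewrite h0 // skew_schurE /kost /kostka sum_m subrr.
Qed.

Lemma syt_schur_expansion A c n P : expansion schur (skew_schur A) c ->
  (syt A n P P)%:R%R = (\sum_(l <- finsupp c) c l * (syt (straight l) n P P)%:R)%R.
Proof.
move=> Ec; apply/esym.
apply: (@syt_inversion n A
  (fun P Q => \sum_(l <- finsupp c) c l * (syt (straight l) n P Q)%:R)%R) => [P1 P2 Q1 Q2 EP EQ|P' Q i lt_i nPi Qi|m sum_m].
- by apply: eq_bigr => l _; rewrite (eq_syt _ EP EQ).
- by rewrite -big_split; apply: eq_bigr => l _; rewrite (syt_add _ lt_i nPi Qi) natrD mulrDr.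
by rewrite Ec; apply: eq_bigr => l _; rewrite /schur skew_schurE /kost /kostka sum_m.
Qed.

Lemma eq_skew_schur_syt A B n P : skew_schur A =1 skew_schur B ->
  syt A n P P = syt B n P P.
Proof.
move=> E; apply/eqP; rewrite -(eqr_nat int); apply/eqP.
apply: (@syt_inversion n B (fun P Q => (syt A n P Q)%:R)%R) => [P1 P2 Q1 Q2 EP EQ|P' Q i lt_i nPi Qi|m sum_m].
- by rewrite (eq_syt _ EP EQ).
- by rewrite (syt_add _ lt_i nPi Qi) natrD.
by rewrite -E skew_schurE /kost /kostka sum_m.
Qed.

(** * Equality of supports *)

Notation dsyt A n P := (syt A n P P).

Lemma dsyt_ncol A n P m : ncol A < m -> dsyt A (m + n) (ext_pred m P) = 0.
Proof.
move=> lt_m; apply: (@syt_ncol A _ _ _ m) => //; first exact: leq_addr.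
by move=> i; apply: ext_pred_lo.
Qed.

Lemma dsyt_straight_behead (l : intpart) n P :
  dsyt (straight l) (head 0 l + n) (ext_pred (head 0 l) P)
  = dsyt (straight (behead_part l)) n P.
Proof. by rewrite -ncol_straight syt_peel_ext syt_peel_straight. Qed.

Definition dsyt_sum (L : seq intpart) (c : intpart -> int) n P : int :=
  (\sum_(l <- L) c l * (dsyt (straight l) n P)%:R)%R.

Section FirstRow.
Variables (L : seq intpart) (m : nat).
Hypothesis L_m : forall l, l \in L -> head 0 l <= m.

Definition behead_family := map behead_part [seq l <- L | head 0 (l : intpart) == m].

Lemma behead_familyE (l : intpart) : l \in behead_family -> cons_part m l \in L.
Proof.
move=> /mapP[l' + ->]; rewrite mem_filter => /andP[/eqP <- l'_L].
by rewrite cons_behead_part.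
Qed.

Lemma behead_family_uniq : uniq L -> uniq behead_family.
Proof.
move=> UL; rewrite map_inj_in_uniq ?filter_uniq // => l l'.
rewrite !mem_filter => /andP[/eqP El _] /andP[/eqP El' _] E.
by rewrite -[l]cons_behead_part El E -El' cons_behead_part.
Qed.

(** A first descent at [m] is impossible for shapes with fewer than [m] columns; for those with
    first row [m] the initial run fills that row, which can then be removed. *)
Lemma dsyt_sum_behead c n P :
  dsyt_sum L c (m + n) (ext_pred m P)
  = dsyt_sum behead_family (c \o cons_part m) n P.
Proof.
rewrite /dsyt_sum big_map big_filter [RHS]big_mkcond; apply: eq_big_seq => l l_L.
case: eqP => [<-|/eqP ne_m]; first by rewrite dsyt_straight_behead /= cons_behead_part.
by rewrite dsyt_ncol ?mulr0 // ncol_straight ltn_neqAle ne_m L_m.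
Qed.

End FirstRow.

Lemma dsyt_sum_ncol L c n P m : (forall l : intpart, l \in L -> head 0 l < m) ->
  dsyt_sum L c (m + n) (ext_pred m P) = 0%R.
Proof.
move=> L_m; rewrite /dsyt_sum big1_seq // => l /andP[_ /L_m lt_m].
by rewrite dsyt_ncol ?mulr0 ?ncol_straight.
Qed.

Lemma max_head (L : seq intpart) : L != [::] ->
  exists2 m, has (fun l : intpart => head 0 l == m) L
           & forall l, l \in L -> head 0 l <= m.
Proof.
elim: L => // l [|l' L] IH _.
  by exists (head 0 l) => [|l']; rewrite /= ?eqxx // inE => /eqP->.
have [m m_in m_max] := IH isT.
have [le_m|lt_m] := leqP (head 0 l) m.
  exists m => [|k]; first by rewrite /= in m_in *; rewrite m_in orbT.
  by rewrite inE => /predU1P[->|/m_max].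
exists (head 0 l) => [|k]; first by rewrite /= eqxx.
by rewrite inE => /predU1P[->//|/m_max/leq_trans]; apply; apply: ltnW.
Qed.

Lemma dsyt_exists A : exists n P, dsyt A n P != 0.
Proof. by have [P] := syt_exists A; exists (nboxes A), P; rewrite -lt0n. Qed.

(** In substance the linear independence of Schur functions, by triangularity in the first row. For
    [m] the longest first row, the shapes with first row [m] still add up to zero after losing it;
    induction on the number of rows makes this subfamily empty, although [m] is attained. *)
Lemma straight_indep L c : uniq L -> {in L, forall l, c l != 0%R} ->
  (forall n P, dsyt_sum L c n P = 0%R) -> L = [::].
Proof.
have [N] : exists N, forall l, l \in L -> size l <= N.
  exists (\max_(l <- L) size (l : intpart)) => l l_L.
  by rewrite (big_rem l) //= leq_maxl.
elim: N L c => [|N IH] L c L_N UL c0 E0.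
  have L0 l : l \in L -> l = empty_part.
    by move=> /L_N; rewrite leqn0 => /nilP El; apply: val_inj.
  case: L UL c0 E0 L0 {L_N} => // l L UL c0 E0 L0; exfalso.
  have [n [P nz]] := dsyt_exists (straight l).
  have EL : L = [::].
    case: L UL L0 {c0 E0} => // l' L /andP[/negP l_L _] L0; case: l_L.
    by rewrite (L0 _ (mem_head _ _)) (L0 l') ?mem_head // in_cons mem_head orbT.
  have /eqP := E0 n P; rewrite EL /dsyt_sum big_seq1 mulf_eq0 pnatr_eq0.
  by rewrite (negbTE nz) orbF; apply/negP/c0; rewrite inE eqxx.
apply/eqP; apply: contraT => /max_head[m m_in m_max].
have : behead_family L m = [::].
  apply: (IH _ (c \o cons_part m)) => [l /mapP[l' + ->]||l l_in|n P].
  - by rewrite mem_filter size_behead => /andP[_ /L_N]; case: (size l').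
  - exact: behead_family_uniq.
  - by rewrite /= c0 ?behead_familyE.
  by rewrite -dsyt_sum_behead.
rewrite /behead_family; move: m_in; rewrite has_filter.
by case: (filter _ L).
Qed.

Definition same_F_support A B := forall n P, (0 < dsyt A n P) = (0 < dsyt B n P).

Lemma same_F_support_closed A B : same_F_support A B ->
  [/\ nboxes A = nboxes B, same_F_support (peel A) (peel B) & same_F_support (tr A) (tr B)].
Proof.
(* A descent set of [peel C], preceded by a run of length [ncol C], occurs for [C], but not for a
   shape with fewer nonempty columns. *)
have le_ncol C D : same_F_support C D -> ncol C <= ncol D.
  move=> CD; have [P gt0] := syt_exists (peel C).
  rewrite leqNgt; apply/negP => lt_m.
  by move: gt0; rewrite -syt_peel_ext CD dsyt_ncol.
move=> AB; have Em : ncol A = ncol B.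
  by apply/eqP; rewrite eqn_leq !le_ncol // => n P; rewrite AB.
split=> [|n P|n P]; last by rewrite !syt_tr.
  by have [P] := syt_exists A; rewrite AB => /syt_size.
by rewrite -!syt_peel_ext -Em.
Qed.

(** The coefficients [c] and [d] are unrelated apart from vanishing nowhere on the common list. Only
    descent counts enter, so that peeling and transposing do not lead back to series. *)
Definition same_schur_support A B := exists L c d, [/\ uniq L,
  {in L, forall l : intpart, c l != 0%R /\ d l != 0%R},
  forall n P, (dsyt A n P)%:R%R = dsyt_sum L c n P
  & forall n P, (dsyt B n P)%:R%R = dsyt_sum L d n P].

Lemma schur_support_neq0 A L c : (forall n P, (dsyt A n P)%:R%R = dsyt_sum L c n P) ->
  L != [::].
Proof.
move=> EA; have [n [P nz]] := dsyt_exists A; apply: contraNneq nz => L0.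
by rewrite -(pnatr_eq0 int) EA L0 /dsyt_sum big_nil.
Qed.

(** If [ncol A] exceeded [m], no shape of [L] would have a tableau with first descent [ncol A],
    although [peel A] has tableaux. If it were smaller, the shapes with first row [m] would cancel
    after losing that row, against [straight_indep]; here independence does the work of nonnegative
    coefficients. *)
Lemma schur_support_ncol A L c m : uniq L -> {in L, forall l, c l != 0%R} ->
  (forall n P, (dsyt A n P)%:R%R = dsyt_sum L c n P) ->
  has (fun l : intpart => head 0 l == m) L -> (forall l, l \in L -> head 0 l <= m) ->
  ncol A = m.
Proof.
move=> UL c0 EA m_in m_max; apply/eqP; rewrite eqn_leq; apply/andP; split.
  rewrite leqNgt; apply/negP => lt_m; have [n [P]] := dsyt_exists (peel A).
  rewrite -syt_peel_ext -(pnatr_eq0 int) EA dsyt_sum_ncol ?eqxx // => l /m_max.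
  by move/leq_ltn_trans; apply.
rewrite leqNgt; apply/negP => lt_m; have : behead_family L m = [::].
  apply: (@straight_indep _ (c \o cons_part m)) => [|l l_in|n P].
  - exact: behead_family_uniq.
  - by rewrite /= c0 ?behead_familyE.
  by rewrite -dsyt_sum_behead // -EA dsyt_ncol.
rewrite /behead_family; move: m_in; rewrite has_filter.
by case: (filter _ L).
Qed.

(** The shapes of [L] with [n] boxes carry all counts of size [n]. If [B] had another size, these
    counts would vanish for [d], so there would be no such shapes by independence, although [A] has
    tableaux. *)
Lemma schur_support_nboxes A B L c d : uniq L ->
  {in L, forall l : intpart, c l != 0%R /\ d l != 0%R} ->
  (forall n P, (dsyt A n P)%:R%R = dsyt_sum L c n P) ->
  (forall n P, (dsyt B n P)%:R%R = dsyt_sum L d n P) -> nboxes A = nboxes B.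
Proof.
move=> UL cd0 EA EB; set n := nboxes A; apply/eqP; apply: contraT => ne_n.
pose Ln := [seq l <- L | nboxes (straight l) == n].
have sumE e P k : dsyt_sum Ln e k P = if k == n then dsyt_sum L e k P else 0%R.
  rewrite /dsyt_sum big_filter; case: eqP => [->|/eqP ne_k].
    rewrite big_mkcond; apply: eq_bigr => l _; case: eqP => // /eqP ne_l.
    by rewrite syt_size0 ?mulr0 // eq_sym.
  rewrite big1 // => l /eqP El; by rewrite syt_size0 ?mulr0 // El.
have Ln0 : Ln = [::].
  apply: (@straight_indep _ d) => [|l|k P].
  - exact: filter_uniq.
  - by rewrite mem_filter => /andP[_ /cd0[]].
  by rewrite sumE; case: eqP => // ->; rewrite -EB syt_size0.
have [P] := syt_exists A; rewrite lt0n -(pnatr_eq0 int) EA.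
have := sumE c P n; rewrite eqxx => <-.
by rewrite Ln0 /dsyt_sum big_nil eqxx.
Qed.

Lemma same_schur_support_closed A B : same_schur_support A B ->
  [/\ nboxes A = nboxes B, same_schur_support (peel A) (peel B) & same_schur_support (tr A) (tr B)].
Proof.
move=> [L [c [d [UL cd0 EA EB]]]]; split.
- exact: schur_support_nboxes UL cd0 EA EB.
- have [m m_in m_max] := max_head (schur_support_neq0 EA).
  have Am : ncol A = m.
    by apply: schur_support_ncol UL _ EA m_in m_max => l /cd0[].
  have Bm : ncol B = m.
    by apply: schur_support_ncol UL _ EB m_in m_max => l /cd0[].
  exists (behead_family L m), (c \o cons_part m), (d \o cons_part m); split.
  + exact: behead_family_uniq.
  + by move=> l /behead_familyE/cd0.
  + by move=> n P; rewrite -syt_peel_ext Am EA dsyt_sum_behead.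
  by move=> n P; rewrite -syt_peel_ext Bm EB dsyt_sum_behead.
(* Transposing complements [P] for [C] and for every straight shape alike, so the coefficients are
   carried over to the conjugate shapes. *)
have trE C e : (forall n P, (dsyt C n P)%:R%R = dsyt_sum L e n P) ->
    forall n P, (dsyt (tr C) n P)%:R%R
      = dsyt_sum (map conj_part L) (e \o conj_part) n P.
  move=> EC n P; rewrite syt_tr EC /dsyt_sum big_map; apply: eq_bigr => l _.
  by rewrite /= conj_partK -syt_straight_tr syt_tr.
exists (map conj_part L), (c \o conj_part), (d \o conj_part); split.
- by rewrite map_inj_uniq //; apply: inv_inj conj_partK.
- by move=> _ /mapP[l l_L ->] /=; rewrite conj_partK; apply: cd0.
- exact: trE.
exact: trE.
Qed.

(** Membership in a Schur support provides some expansion, which has to be identified with a fixed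
    one. The difference of the coefficients, restricted to where it is nonzero, is a family to which
    [straight_indep] applies. *)
Lemma expansion_schur_uniq f c d :
  expansion schur f c -> expansion schur f d -> c = d.
Proof.
move=> Ec Ed; pose s := (finsupp c `|` finsupp d)%fset.
pose L := [seq l <- s | c l != d l]; pose e l := (c l - d l)%R.
have sumE n P (h : {fsfun intpart -> int with 0%R}) : {subset finsupp h <= s} ->
    (\sum_(l <- finsupp h) h l * (dsyt (straight l) n P)%:R)%R = dsyt_sum s h n P.
  by move=> sub; apply: finsupp_sum; rewrite ?fset_uniq.
have c_s : {subset finsupp c <= s} by move=> l; rewrite in_fsetU => ->.
have d_s : {subset finsupp d <= s} by move=> l; rewrite in_fsetU orbC => ->.
have L0 : L = [::].
  apply: (@straight_indep _ e) => [|l|n P].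
  - by rewrite filter_uniq ?fset_uniq.
  - by rewrite mem_filter subr_eq0 => /andP[].
  transitivity (dsyt_sum s e n P).
    rewrite /dsyt_sum big_filter big_mkcond; apply: eq_bigr => l _.
    by rewrite /e; case: eqP => //= ->; rewrite subrr mul0r.
  transitivity (dsyt_sum s c n P - dsyt_sum s d n P)%R.
    by rewrite /dsyt_sum -sumrB; apply: eq_bigr => l _; rewrite mulrBl.
  apply/eqP; rewrite subr_eq0 -(sumE _ _ _ c_s) -(sumE _ _ _ d_s); apply/eqP.
  pose h (x : {fsfun intpart -> int with 0%R}) P Q :=
    (\sum_(l <- finsupp x) x l * (syt (straight l) n P Q)%:R)%R.
  apply/eqP; rewrite -subr_eq0; apply/eqP.
  apply: (@interval_inversion n (fun P Q => h c P Q - h d P Q)%R) => //.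
  - move=> P1 P2 Q1 Q2 EP EQ; rewrite /h.
    by congr (_ - _)%R; apply: eq_bigr => l _; rewrite (eq_syt _ EP EQ).
  - move=> P' Q i lt_i nPi Qi; rewrite addrACA -opprD /h -!big_split.
    by congr (_ - _)%R; apply: eq_bigr => l _; rewrite (syt_add _ lt_i nPi Qi) natrD mulrDr.
  move=> Q; have [m [sum_m Em]] := monom_exists n Q.
  suff E x : expansion schur f x -> h x pred0 Q = f m by rewrite !E ?subrr.
  move=> ->; apply: eq_bigr => l _; rewrite /schur skew_schurE /kost /kostka sum_m.
  by congr (_ * _%:R)%R; apply: eq_syt => // i /Em.
apply/fsfunP => l; have [l_s|] := boolP (l \in s).
  have : l \notin L by rewrite L0.
  by rewrite mem_filter l_s andbT negbK => /eqP.
by rewrite in_fsetU negb_or => /andP[lc ld]; rewrite !fsfun_dflt.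
Qed.

Lemma supp_s_same_support A B : (forall l, supp_s A l <-> supp_s B l) -> same_schur_support A B.
Proof.
have sub C D c d : (forall l, supp_s C l <-> supp_s D l) ->
    expansion schur (skew_schur C) c -> expansion schur (skew_schur D) d ->
    {subset finsupp c <= finsupp d}.
  move=> CD Ec Ed l; rewrite mem_finsupp => cl.
  have /CD[d' Ed' d'l] : supp_s C l by exists c.
  by rewrite (expansion_schur_uniq Ed Ed') mem_finsupp.
move=> AB; have [c Ec] := schur_expansion_exists A.
have [d Ed] := schur_expansion_exists B.
have Ecd : finsupp c = finsupp d.
  apply/fsetP => l; apply/idP/idP; first exact: (sub A B).
  by apply: (sub B A) => // k; rewrite AB.
exists (finsupp c), c, d; split; first exact: fset_uniq.
- by move=> l l_c; split; [|move: l_c; rewrite Ecd]; rewrite -mem_finsupp.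
- by move=> n P; apply: syt_schur_expansion.
by move=> n P; rewrite Ecd; apply: syt_schur_expansion.
Qed.

(** * Coefficients in the fundamental basis *)

Lemma fundamental_compE a m : is_comp a ->
  fundamental_qsym a m = ((sumn (exponents m) == sumn a) &&
    all (fun i => psum a i ==> psum (exponents m) i) (iota 1 (sumn a).-1))%:R%R.
Proof.
move=> a_pos; have [sD ED] := set_of_compP a_pos (erefl (sumn a)).
rewrite -{1}ED fundamentalE //; case: eqP => //= sum_e; congr (nat_of_bool _)%:R%R.
have e_pos := exponents_comp m.
apply/subsetP/allP => [H i|H i i_D].
  rewrite mem_iota => /andP[i0 lt_i]; have {}lt_i : i < sumn a by lia.
  have := H (Ordinal lt_i); rewrite !mem_set_of_comp // => {}H.
  exact/implyP.
have i0 : 0 < i by move/(subsetP sD): i_D; rewrite inE.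
move: i_D; rewrite !mem_set_of_comp //; apply/implyP/H.
by rewrite mem_iota i0; have := ltn_ord i; lia.
Qed.

Lemma comp_psum_inj a b : is_comp a -> is_comp b -> sumn a = sumn b ->
  (forall i, 0 < i < sumn a -> psum a i = psum b i) -> a = b.
Proof.
move=> a_pos b_pos sum_ab E.
have [sa Ea] := set_of_compP a_pos (erefl (sumn a)).
have [sb Eb] := set_of_compP b_pos (esym sum_ab).
rewrite -Ea -Eb; congr comp_of_set; apply/setP => i.
have [i0|i0] := posnP i.
  by apply/idP/idP => [/(subsetP sa)|/(subsetP sb)]; rewrite inE i0.
by rewrite !mem_set_of_comp // E // i0 ltn_ord.
Qed.

(** The function [h] adds the coefficients of the compositions whose partial sums lie between [P]
    and [Q]. It splits like the tableau counts and agrees with them for empty [P]; at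
    [P = Q = psum a] only [a] is left. As [c] is an arbitrary expansion, its coefficients are
    unique. *)
Lemma fundamental_coef A (c : {fsfun composition -> int with 0%R}) (a : composition) :
  expansion (fun a : composition => fundamental_qsym a) (skew_schur A) c ->
  c a = (dsyt A (sumn a) (psum a))%:R%R.
Proof.
move=> Ec; set n := sumn a.
pose sel (b : composition) (P Q : pred nat) := (sumn b == n) &&
  all (fun i => (P i ==> psum b i) && (psum b i ==> Q i)) (iota 1 n.-1).
pose h P Q := (\sum_(b <- finsupp c) c b * (sel b P Q)%:R)%R.
have in_n i : (i \in iota 1 n.-1) = (0 < i < n) by rewrite mem_iota; lia.
rewrite -(@syt_inversion n A h).
- rewrite /h (bigID (pred1 a)) /= [X in (_ + X)%R]big1 ?addr0 => [|b ne_b]; last first.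
    suff -> : sel b (psum a) (psum a) = false by rewrite mulr0.
    apply/negbTE; apply: contra ne_b => /andP[/eqP sum_b /allP H].
    apply/eqP; apply: val_inj; apply: comp_psum_inj; rewrite ?(valP b) ?(valP a) //.
    move=> i; rewrite sum_b -in_n => /H/andP[/implyP H1 /implyP H2].
    by apply/idP/idP.
  have sel_a : sel a (psum a) (psum a).
    by rewrite /sel eqxx; apply/allP => i _; rewrite implybb.
  have [a_c|a_c] := boolP (a \in finsupp c).
    rewrite -big_filter (@perm_big _ _ _ _ _ [:: a]).
      by rewrite big_seq1 sel_a mulr1.
    apply: uniq_perm; rewrite ?filter_uniq ?fset_uniq // => b.
    by rewrite mem_filter inE; case: eqP => // ->.
  by rewrite fsfun_dflt // big1 // => b /eqP->; rewrite fsfun_dflt // mul0r.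
- move=> P P' Q Q' EP EQ; apply: eq_bigr => b _; congr (_ * (nat_of_bool (_ && _))%:R)%R.
  by apply: eq_in_all => i; rewrite in_n => lt_i; rewrite EP ?EQ.
- move=> P Q i lt_i nPi Qi; rewrite /h -big_split; apply: eq_bigr => b _ /=.
  rewrite -mulrDr -natrD; congr (_ * _%:R)%R; rewrite /sel.
  case: (sumn b == n) => //=.
  have i_in : i \in iota 1 n.-1 by rewrite in_n.
  have [bi|nbi] := boolP (psum b i).
    have -> : all (fun j => (P j ==> psum b j) && (psum b j ==> predD1 Q i j)) (iota 1 n.-1) = false.
      by apply/negbTE/negP => /allP/(_ i i_in); rewrite bi /= eqxx andbF.
    rewrite addn0; congr nat_of_bool; apply: eq_in_all => j _ /=.
    by case: eqP => [->|//]; rewrite bi (negbTE nPi).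
  have -> : all (fun j => (predU1 i P j ==> psum b j) && (psum b j ==> Q j)) (iota 1 n.-1) = false.
    by apply/negbTE/negP => /allP/(_ i i_in); rewrite (negbTE nbi) /= eqxx.
  rewrite add0n; congr nat_of_bool; apply: eq_in_all => j _ /=.
  by case: eqP => [->|//]; rewrite (negbTE nbi).
move=> m sum_m; rewrite Ec; apply: eq_bigr => b _.
rewrite fundamental_compE ?(valP b) // sum_m /sel eq_sym.
by case: eqP => // <-.
Qed.

Lemma fundamental_expansion_exists A : exists c,
  expansion (fun a : composition => fundamental_qsym a) (skew_schur A) c.
Proof.
pose a0 := @Composition [::] isT.
apply: (@list_expansion _ _ _
  [seq (insubd a0 (descent_comp T), 1%R) | T <- enum (@is_SYT A)]) => m.
rewrite big_map big_enum /skew_schur; apply: eq_bigr => T sT.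
rewrite mul1r insubdK //.
by case: (comp_of_setP (descent_set_interval sT)).
Qed.

Lemma supp_F_dsyt A (a : composition) :
  supp_F A a <-> 0 < dsyt A (sumn a) (psum a).
Proof.
split=> [[c Ec]|gt0]; first by rewrite (fundamental_coef _ Ec) ltr0n.
have [c Ec] := fundamental_expansion_exists A; exists c => //.
by rewrite (fundamental_coef _ Ec) ltr0n.
Qed.

(** At the positions that matter, every [P] is the set of partial sums of a composition, found as
    the exponents of a monomial. *)
Lemma supp_F_same_support A B : (forall a, supp_F A a <-> supp_F B a) -> same_F_support A B.
Proof.
move=> AB n P; have [m [<- Em]] := monom_exists n P.
have E C : dsyt C (sumn (exponents m)) P =
           dsyt C (sumn (exponents m)) (psum (exponents m)).
  by apply: eq_syt => i lt_i; rewrite Em.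
rewrite !E; have := AB (Composition (exponents_comp m)).
by rewrite !supp_F_dsyt /= => H; apply/idP/idP => /H.
Qed.

Theorem corollary4p3 (A B : skew_shape) :
  (((forall k, 1 <= k -> rows k A = rows k B) <->
    (forall l, 1 <= l -> cols l A = cols l B))
   /\
   ((forall l, 1 <= l -> cols l A = cols l B) <->
    (forall k l, 1 <= k -> 1 <= l -> rects k l A = rects k l B)))
  /\
  (skew_schur A =1 skew_schur B
   \/ (forall la : intpart, supp_s A la <-> supp_s B la)
   \/ (forall a : composition, supp_F A a <-> supp_F B a) ->
   (forall k, 1 <= k -> rows k A = rows k B)
   /\ (forall l, 1 <= l -> cols l A = cols l B)
   /\ (forall k l, 1 <= k -> 1 <= l -> rects k l A = rects k l B)).
Proof.
have rR := rows_rects A B; have cR := cols_rects A B; split.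
  by split=> //; rewrite rR cR.
move=> H; rewrite rR cR; suff : forall k l, 1 <= k -> 1 <= l -> rects k l A = rects k l B by [].
case: H => [AB|[AB|AB]].
(* Equal series have equally many tableaux for each descent set, so this case is an instance of
   equal [F]-supports. *)
- apply: (rects_rel same_F_support_closed) => n P.
  by rewrite (eq_skew_schur_syt _ _ AB).
- exact: (rects_rel same_schur_support_closed) (supp_s_same_support AB).
exact: (rects_rel same_F_support_closed) (supp_F_same_support AB).
Qed.
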